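(* Let $\mathsf{C}_B\subset V_B$ be a proper cone, $\phi$ a linear form in the interior of $\mathsf{C}_B^*$, and $K_\phi=\mathsf{C}_B\cap\phi^{-1}(1)$. For every integer $k\ge1$, the following are equivalent: (i) for every proper cone $\mathsf{C}_A\subset V_A$ (in any finite-dimensional real vector space $V_A$), $\mathsf{C}_A\otimes_{\min}\mathsf{C}_B=(\mathrm{Id}_{V_A}\otimes\gamma_k^\phi)(\mathsf{C}_A\otimes_{\max}\mathsf{C}_B^{\otimes_{\max}k})$; (ii) $K_\phi$ is affinely equivalent to a Cartesian product of at most $k$ simplices.
   Context: A convex cone $\mathsf{C}\subset V$ ($V$ a finite-dimensional real vector space) is proper if it is closed, contains no line, and is not contained in any hyperplane. Its dual is $\mathsf{C}^*=\{f\in V^*: f(x)\ge 0 \ \forall x\in\mathsf{C}\}$. For proper cones $\mathsf{C}_A\subset V_A$, $\mathsf{C}_B\subset V_B$, the minimal tensor product is $\mathsf{C}_A\otimes_{\min}\mathsf{C}_B=\mathrm{conv}\{x\otimes y: x\in\mathsf{C}_A, y\in\mathsf{C}_B\}$ and the maximal tensor product is $\mathsf{C}_A\otimes_{\max}\mathsf{C}_B=\{z\in V_A\otimes V_B: (f\otimes g)(z)\ge 0 \ \forall f\in\mathsf{C}_A^*, g\in\mathsf{C}_B^*\}$; $\mathsf{C}^{\otimes_{\max} k}$ denotes the $k$-fold maximal tensor power. The $k$th reduction map is $\gamma_k^\phi=\frac1k\sum_{j=1}^k \phi^{\otimes(j-1)}\otimes\mathrm{Id}_{V_B}\otimes\phi^{\otimes(k-j)}:V_B^{\otimes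 k}\to V_B$. Simplices may be $0$-dimensional (a point). *)

(* Defs.v *)
From mathcomp Require Import all_boot all_algebra all_classical all_reals all_analysis.
Import numFieldNormedType.Exports.
Import GRing.Theory Num.Theory.

Set Implicit Arguments.
Unset Strict Implicit.
Unset Printing Implicit Defensive.

Local Open Scope classical_set_scope.
Local Open Scope ring_scope.

(* A finite-dimensional real vector space is modelled as  I -> R  for a
   finite index type I (coordinates in a fixed basis).  Its dual is also
   modelled as I -> R via the pairing  <f, x> = \sum_i f i * x i.
   V_A (x) V_B is modelled as  I * J -> R,  with  (x (x) y)(i,j) = x i * y j.
   V^{(x) k} is modelled as  {ffun 'I_k -> J} -> R  (basis e_{t 0} (x) ... (x) e_{t (k-1)}). *)

Section Cones.
Variable R : realType.

Definition pairing (I : finType) (f x : I -> R) : R := \sum_i f i * x i.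

(* Topology on I -> R: the product topology (= Euclidean topology, I finite). *)
Definition closed_vset (I : finType) (C : set (I -> R)) : Prop :=
  closed (C : set {ptws I -> R}).
Definition interior_vset (I : finType) (C : set (I -> R)) : set (I -> R) :=
  interior (C : set {ptws I -> R}).

Definition convex_cone (I : finType) (C : set (I -> R)) : Prop :=
  [/\ C (fun _ => 0),
      (forall x y, C x -> C y -> C (fun i => x i + y i)) &
      (forall a x, 0 <= a -> C x -> C (fun i => a * x i))].

(* proper cone: closed convex cone, contains no line, not contained in any
   hyperplane (through the origin, equivalently any hyperplane since 0 \in C) *)
Definition proper_cone (I : finType) (C : set (I -> R)) : Prop :=
  [/\ convex_cone C, closed_vset C,
      (forall x, C x -> C (fun i => - x i) -> x = (fun _ => 0)) &
      (forall f : I -> R, (forall x, C x -> pairing f x = 0) -> f = (fun _ => 0))].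

Definition dual_cone (I : finType) (C : set (I -> R)) : set (I -> R) :=
  [set f | forall x, C x -> 0 <= pairing f x].

Definition conv_hull (T : finType) (S : set (T -> R)) : set (T -> R) :=
  [set z | exists (N : nat) (w : 'I_N -> R) (p : 'I_N -> T -> R),
      [/\ (forall i, 0 <= w i), \sum_i w i = 1, (forall i, S (p i)) &
          z = (fun t => \sum_i w i * p i t)]].

Definition tensor (I J : finType) (x : I -> R) (y : J -> R) : I * J -> R :=
  fun p => x p.1 * y p.2.

Definition min_tensor (I J : finType) (CA : set (I -> R)) (CB : set (J -> R))
  : set (I * J -> R) :=
  conv_hull [set z | exists x y, [/\ CA x, CB y & z = tensor x y]].

Definition max_tensor (I J : finType) (CA : set (I -> R)) (CB : set (J -> R))
  : set (I * J -> R) :=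
  [set z | forall f g, dual_cone CA f -> dual_cone CB g -> 0 <= pairing (tensor f g) z].

Definition multitensor (J : finType) (k : nat) (ys : 'I_k -> J -> R)
  : {ffun 'I_k -> J} -> R :=
  fun t => \prod_(l < k) ys l (t l).

Definition max_tensor_pow (J : finType) (C : set (J -> R)) (k : nat)
  : set ({ffun 'I_k -> J} -> R) :=
  [set z | forall fs : 'I_k -> J -> R, (forall l, dual_cone C (fs l)) ->
             0 <= pairing (multitensor fs) z].

(* k-th reduction map gamma_k^phi : V_B^{(x) k} -> V_B, the linear map with
   gamma(e_{t0} (x) ... (x) e_{t(k-1)}) =
     1/k \sum_l (\prod_{l' <> l} phi(e_{t l'})) e_{t l}. *)
Definition reduction (J : finType) (k : nat) (phi : J -> R)
  (z : {ffun 'I_k -> J} -> R) : J -> R :=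
  fun j => (k%:R)^-1 * \sum_(l < k) \sum_(t : {ffun 'I_k -> J} | t l == j)
             z t * \prod_(l' < k | l' != l) phi (t l').

Definition id_tensor_map (I T J : finType) (L : (T -> R) -> (J -> R))
  (z : I * T -> R) : I * J -> R :=
  fun p => L (fun t => z (p.1, t)) p.2.

Definition K_phi (J : finType) (C : set (J -> R)) (phi : J -> R) : set (J -> R) :=
  [set x | C x /\ pairing phi x = 1].

Definition is_affine (I J : finType) (T : (I -> R) -> (J -> R)) : Prop :=
  exists (M : J -> I -> R) (b : J -> R),
    forall x, T x = (fun j => \sum_i M j i * x i + b j).

Definition affinely_equivalent (I J : finType) (K : set (I -> R)) (P : set (J -> R))
  : Prop :=
  exists (T : (I -> R) -> (J -> R)) (S : (J -> R) -> (I -> R)),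
    [/\ is_affine T, is_affine S, T @` K = P & S @` P = K] /\
    (forall x, K x -> S (T x) = x) /\ (forall y, P y -> T (S y) = y).

(* Cartesian product of the standard simplices Delta_{d 0} x ... x Delta_{d (r-1)},
   Delta_d = {x in R^{d+1} | x >= 0, sum x = 1} (dimension d >= 0),
   realised in R^{sum_i (d i + 1)} indexed by the sigma type. *)
Definition simplex_prod (r : nat) (d : 'I_r -> nat)
  : set ({i : 'I_r & 'I_(d i).+1} -> R) :=
  [set x | (forall p, 0 <= x p) /\
           (forall i : 'I_r, \sum_(j : 'I_(d i).+1) x (Tagged (fun i => 'I_(d i).+1) j) = 1)].

End Cones.

Arguments reduction {R J} k phi z.
Arguments max_tensor_pow {R J} C k _.
Arguments simplex_prod {R r} d _.

(* Main.v *)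
Require Import Defs.
From mathcomp Require Import all_boot all_algebra all_classical all_reals all_analysis.
From mathcomp Require Import all_order ring lra.
Import numFieldNormedType.Exports.
Import Order.TTheory GRing.Theory Num.Theory.
Set Implicit Arguments.
Unset Strict Implicit.
Unset Printing Implicit Defensive.
Local Open Scope classical_set_scope.
Local Open Scope ring_scope.

(** Taking for C_A the dual of the k-fold maximal tensor power of C_B and for the
    tensor the identity, (i) says that the reduction map is entanglement breaking:
      gamma_k = \sum_(s, e) c s e  f_(s 1) (x) ... (x) f_(s k) (x) y_e,  c s e >= 0,
    and then C_B is generated by finitely many y_e (the vertices of K) and its dual
    by finitely many f_b (the facets of K).  Conversely, such a decomposition gives
    (i) for every C_A by the bipolar theorem.

    If c s e > 0, every facet missing y_e occurs among the f_(s l) (evaluate at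
    points of the facet), so a vertex misses at most k facets.  Evaluating all
    arguments but one at a vertex v shows that K is simple at v.  On the edge from
    v to w, the coefficient of w in the decomposition of x = x (x) ... (x) x is the
    edge parameter t; as each of its terms is divisible by any facet functional
    missing v and w, such a functional is constant on the edge.  Hence in the
    coordinates of the simple vertex v every facet missing v reads
    1 - (sum of a block of coordinates), the blocks being disjoint: K is a product
    of simplices, one for each facet missing v.

    For a product of r <= k simplices, the decomposition is obtained by drawing the
    i-th factor of the point from the slot s + i modulo k and averaging over s. *)

(** * Finitely generated cones: Fourier-Motzkin elimination, Farkas' lemma, minimal generators *)

Section FinitelyGenerated.
Variable R : realType.

Definition fg_cone (I J : finType) (u : I -> J -> R) : set (J -> R) :=
  [set x | exists c : I -> R, (forall i, 0 <= c i) /\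
                              x = (fun j => \sum_i c i * u i j)].

Lemma pairingC (J : finType) (f x : J -> R) : pairing f x = pairing x f.
Proof. by apply: eq_bigr => j _; rewrite mulrC. Qed.

Lemma pairing_sumr (I J : finType) (f : J -> R) (c : I -> R) (u : I -> J -> R) :
  pairing f (fun j => \sum_i c i * u i j) = \sum_i c i * pairing f (u i).
Proof.
rewrite /pairing; under eq_bigr do rewrite mulr_sumr.
rewrite exchange_big; apply: eq_bigr => i _; rewrite mulr_sumr.
by apply: eq_bigr => j _; rewrite mulrCA.
Qed.

Lemma pairing_suml (I J : finType) (x : J -> R) (c : I -> R) (u : I -> J -> R) :
  pairing (fun j => \sum_i c i * u i j) x = \sum_i c i * pairing (u i) x.
Proof.
by rewrite pairingC pairing_sumr; apply: eq_bigr => i _; rewrite pairingC.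
Qed.

Lemma pairing_lin (J : finType) (f x y : J -> R) (a b : R) :
  pairing f (fun j => a * x j + b * y j) = a * pairing f x + b * pairing f y.
Proof.
rewrite /pairing 2!mulr_sumr -big_split; apply: eq_bigr => j _ /=; ring.
Qed.

Lemma pairing_linl (J : finType) (f g x : J -> R) (a b : R) :
  pairing (fun j => a * f j + b * g j) x = a * pairing f x + b * pairing g x.
Proof. by rewrite pairingC pairing_lin !(pairingC x). Qed.

Lemma pairing_scale (J : finType) (f x : J -> R) (a : R) :
  pairing f (fun j => a * x j) = a * pairing f x.
Proof. by rewrite /pairing mulr_sumr; apply: eq_bigr => j _; ring. Qed.

Lemma pairing_scalel (J : finType) (f x : J -> R) (a : R) :
  pairing (fun j => a * f j) x = a * pairing f x.
Proof. by rewrite pairingC pairing_scale pairingC. Qed.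

Lemma pairing0 (J : finType) (f : J -> R) : pairing f (fun _ => 0) = 0.
Proof. by rewrite /pairing big1 // => j _; rewrite mulr0. Qed.

Lemma pairing0l (J : finType) (f : J -> R) : pairing (fun _ => 0) f = 0.
Proof. by rewrite pairingC pairing0. Qed.

Lemma pairing_delta (J : finType) (f : J -> R) (j : J) :
  pairing f (fun i => (i == j)%:R) = f j.
Proof.
rewrite /pairing (bigD1 j) //= eqxx mulr1 big1 ?addr0 // => i /negPf ->.
by rewrite mulr0.
Qed.

Lemma pairing_self_ge0 (J : finType) (x : J -> R) : 0 <= pairing x x.
Proof. by apply: sumr_ge0 => j _; rewrite -expr2 sqr_ge0. Qed.

Lemma pairing_self_eq0 (J : finType) (x : J -> R) :
  pairing x x <= 0 -> x = (fun _ => 0).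
Proof.
move=> h; have /eqP : pairing x x = 0.
  by apply/eqP; rewrite eq_le h pairing_self_ge0.
rewrite /pairing psumr_eq0; last by move=> j _; rewrite -expr2 sqr_ge0.
move=> /allP h0; apply/funext => j.
by have := h0 j (mem_index_enum _); rewrite /= mulf_eq0 orbb => /eqP.
Qed.

Lemma fg_cone_gen (I J : finType) (u : I -> J -> R) (i : I) : fg_cone u (u i).
Proof.
exists (fun i' => (i' == i)%:R); split=> [i'|]; first by rewrite ler0n.
apply/funext => j; rewrite (bigD1 i) //= eqxx mul1r big1 ?addr0 // => i' /negPf ->.
by rewrite mul0r.
Qed.

Lemma fg_cone_sum (I I' J : finType) (u : I -> J -> R) (c : I' -> R)
    (x : I' -> J -> R) :
  (forall i, 0 <= c i) -> (forall i, fg_cone u (x i)) ->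
  fg_cone u (fun j => \sum_i c i * x i j).
Proof.
move=> c0 /choice [a ha].
exists (fun i => \sum_i' c i' * a i' i); split.
  by move=> i; apply: sumr_ge0 => i' _; rewrite mulr_ge0 //; case: (ha i').
apply/funext => j; under [RHS]eq_bigr do rewrite mulr_suml.
rewrite exchange_big; apply: eq_bigr => i' _.
have [_ ->] := ha i'; rewrite mulr_sumr; apply: eq_bigr => i _.
by rewrite mulrA.
Qed.

Lemma fg_cone_recl (J : finType) n (u : 'I_n.+1 -> J -> R) (x : J -> R) :
  fg_cone u x <-> exists t, 0 <= t /\
    fg_cone (fun i => u (lift ord0 i)) (fun j => x j - t * u ord0 j).
Proof.
split=> [[c [c0 ->]]|[t [t0 [c [c0 hc]]]]].
  exists (c ord0); split=> //; exists (fun i => c (lift ord0 i)); split=> //.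
  by apply/funext => j; rewrite big_ord_recl addrC addKr.
exists (fun i => if unlift ord0 i is Some i' then c i' else t); split.
  by move=> i; case: (unlift _ _).
apply/funext => j; rewrite big_ord_recl unlift_none.
under eq_bigr do rewrite liftK.
by have /(congr1 (fun h => h j)) /= <- := hc; rewrite addrC subrK.
Qed.

(* Fourier-Motzkin elimination of the scalar t. *)
Lemma exists_scalar (M : finType) (p q : M -> R) :
  (exists t, 0 <= t /\ forall r, 0 <= p r - t * q r) <->
  ((forall r, 0 <= q r -> 0 <= p r) /\
   (forall r s, 0 < q r -> q s < 0 -> 0 <= q r * p s - q s * p r)).
Proof.
split=> [[t [t0 h]]|[h1 h2]].
  split=> [r qr|r s qr qs].
    have := h r; rewrite subr_ge0; apply: le_trans; exact: mulr_ge0.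
  have := h r; have := h s; nra.
have [t ht] : exists t, [/\ 0 <= t, (forall s, q s < 0 -> p s / q s <= t) &
    (forall r, 0 < q r -> t <= p r / q r)].
  exists (\big[Num.max/0]_(s | q s < 0) (p s / q s)); split.
  - exact: bigmax_ge_id.
  - by move=> s qs; apply: le_bigmax_cond.
  - move=> r qr; apply: bigmax_le => [|s qs].
      by rewrite divr_ge0 ?(ltW qr) // h1 // ltW.
    rewrite ler_pdivlMr // mulrAC ler_ndivrMr //.
    by have := h2 r s qr qs; rewrite subr_ge0 mulrC [q r * _]mulrC.
case: ht => t0 hl hu; exists t; split=> // r; rewrite subr_ge0.
have [qr|qr|qr] := ltgtP (q r) 0.
- by rewrite -ler_ndivrMr // hl.
- by rewrite -ler_pdivlMr // hu.
- by rewrite qr mulr0 h1 ?qr.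
Qed.

(** Induction on the number of generators: the coefficient [t] of the first one is eliminated from
    the inequalities describing the cone of the others. *)
Lemma weyl_ord (J : finType) n (u : 'I_n -> J -> R) :
  exists (M : finType) (h : M -> J -> R),
    forall x, fg_cone u x <-> forall r, 0 <= pairing (h r) x.
Proof.
elim: n u => [|n IH] u.
  exists (J + J)%type, (fun r i => match r with
    inl j => (i == j)%:R | inr j => - (i == j)%:R end) => x; split.
    by case=> c [_ ->] r; rewrite pairing_sumr big_ord0.
  move=> h; exists (fun _ => 0); split=> //; apply/funext => j.
  rewrite big_ord0; apply/eqP; rewrite eq_le.
  have := h (inl j); have := h (inr j); rewrite ![pairing _ x]pairingC.
  have -> : (fun i : J => - (i == j)%:R) = (fun i => -1 * (i == j)%:R) :> (J -> R).
    by apply/funext => i; rewrite mulN1r.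
  by rewrite pairing_scale pairing_delta => h1 ->; rewrite andbT; lra.
have [M [h hM]] := IH (fun i => u (lift ord0 i)).
pose q r := pairing (h r) (u ord0).
(* Each pair with [q] of opposite signs gives the positive combination that vanishes at [u ord0].
   Indices without a constraint receive the trivial form 0. *)
exists (M + M * M)%type, (fun r => match r with
  | inl r => if 0 <= q r then h r else (fun _ => 0)
  | inr (r, s) => if (0 < q r) && (q s < 0)
      then (fun j => q r * h s j + (- q s) * h r j) else (fun _ => 0) end) => x.
rewrite fg_cone_recl.
have -> : (exists t, 0 <= t /\
     fg_cone (fun i => u (lift ord0 i)) (fun j => x j - t * u ord0 j)) <->
   (exists t, 0 <= t /\ forall r, 0 <= pairing (h r) x - t * q r).
  split=> -[t [t0 ht]]; exists t; split=> //.
    move=> r; have := (hM _).1 ht r; rewrite (_ : (fun j => _) =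
      (fun j => 1 * x j + (- t) * u ord0 j)) ?pairing_lin ?mul1r ?mulNr //.
    by apply/funext => j; rewrite mul1r mulNr.
  apply: (hM _).2 => r; have := ht r; rewrite (_ : (fun j => _) =
      (fun j => 1 * x j + (- t) * u ord0 j)) ?pairing_lin ?mul1r ?mulNr //.
  by apply/funext => j; rewrite mul1r mulNr.
rewrite exists_scalar; split.
  move=> [h1 h2] [r|[r s]].
    by case: ifP => [/h1//|_]; rewrite pairing0l.
  case: ifP => [/andP[qr qs]|_]; last by rewrite pairing0l.
  by rewrite pairing_linl mulNr h2.
move=> H; split=> [r qr|r s qr qs].
  by have := H (inl r); rewrite qr.
by have := H (inr (r, s)); rewrite qr qs /= pairing_linl mulNr.
Qed.

Lemma weyl (I J : finType) (u : I -> J -> R) :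
  exists (M : finType) (h : M -> J -> R),
    forall x, fg_cone u x <-> forall r, 0 <= pairing (h r) x.
Proof.
have [M [h hM]] := weyl_ord (fun i : 'I_#|I| => u (enum_val i)).
exists M, h => x; rewrite -hM; split.
  move=> [c [c0 ->]]; exists (fun i => c (enum_val i)); split=> //.
  apply/funext => j; rewrite (reindex (@enum_val I I)) //=.
  by apply: onW_bij; apply: enum_val_bij.
move=> [c [c0 ->]]; exists (fun i => c (enum_rank i)); split=> //.
apply/funext => j; rewrite [RHS](reindex (@enum_val I I)) /=; last first.
  by apply: onW_bij; apply: enum_val_bij.
by apply: eq_bigr => i _; rewrite enum_valK.
Qed.

(** Each form [h r] describing the cone is nonnegative on the generators, so the hypothesis applies
    to [z = h r]. *)
Lemma farkas (I J : finType) (u : I -> J -> R) (a : J -> R) :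
  (forall z, (forall i, 0 <= pairing (u i) z) -> 0 <= pairing a z) ->
  fg_cone u a.
Proof.
move=> ha; have [M [h hM]] := weyl u.
apply: (hM _).2 => r; rewrite pairingC; apply: ha => i; rewrite pairingC.
by apply: (hM _).1; exact: fg_cone_gen.
Qed.

(** The coefficient of [u i] itself is forced to be 1; thus the [u i] lie on distinct extreme rays
    of the cone they generate. *)
Definition irredundant (I J : finType) (u : I -> J -> R) : Prop :=
  forall i c, (forall j, 0 <= c j) -> u i = (fun j => \sum_i' c i' * u i' j) ->
    forall i', c i' = (i' == i)%:R.

(** A generating subfamily of least size is taken. As [h] is positive on its members, comparing
    values of [h] in a relation for [v a] leaves no room for another generator. *)
Lemma minimal_generators (I J : finType) (u : I -> J -> R) (h : J -> R) :
  (forall i, 0 <= pairing h (u i)) ->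
  (forall i, pairing h (u i) = 0 -> u i = (fun _ => 0)) ->
  exists (n : nat) (v : 'I_n -> J -> R),
    [/\ forall a, exists i, v a = u i, forall i, fg_cone v (u i) & irredundant v].
Proof.
move=> h0 h1.
pose P n := `[< exists v : 'I_n -> J -> R, (forall a, exists i, v a = u i) /\
                forall i, fg_cone v (u i) >].
have exP : exists n, P n.
  exists #|I|; apply/asboolP; exists (fun a => u (enum_val a)); split.
    by move=> a; exists (enum_val a).
  by move=> i; rewrite -[i]enum_rankK; exact: fg_cone_gen.
have [n /asboolP[v [vu uv]] nmin] := ex_minnP exP.
exists n, v; split=> // a c c0 va.
have drop b : ~ fg_cone (fun i : 'I_n.-1 => v (lift b i)) (v b).
  case: n v vu uv nmin a c c0 va b => [|n] v vu uv nmin a c c0 va b; first by case: a {va}.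
  move=> vb; have : (n.+1 <= n)%N; last by rewrite ltnn.
  apply: nmin; apply/asboolP; exists (fun i => v (lift b i)); split=> // i.
  have [d [d0 ->]] := uv i; apply: fg_cone_sum => // b'.
  have [b'' ->|->] := unliftP b b'; last exact: vb.
  exact: (fg_cone_gen (fun i => v (lift b i))).
have hv0 b : 0 < pairing h (v b).
  rewrite lt_def; have [i hi] := vu b; rewrite hi h0 andbT.
  apply/eqP => /h1; rewrite -hi => vb; apply: (drop b); rewrite vb.
  by exists (fun _ => 0); split=> //; apply/funext => j; rewrite big1// => ?; rewrite mul0r.
have ca j : (1 - c a) * v a j = \sum_i c (lift a i) * v (lift a i) j.
  have := congr1 (fun g => g j) va; rewrite /= (bigD1_ord a) //= => E.
  by rewrite mulrBl mul1r {1}E addrAC subrr add0r.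
have hca : (1 - c a) * pairing h (v a) =
    \sum_i c (lift a i) * pairing h (v (lift a i)).
  by rewrite -pairing_scale -pairing_sumr; congr (pairing h _); apply/funext.
have nn i : 0 <= c i * pairing h (v i) by rewrite mulr_ge0 // ltW.
(* If [c a < 1], dividing by [1 - c a] expresses [v a] through the other generators, against
   minimality. *)
have cage : 1 <= c a.
  rewrite leNgt; apply/negP => ca1; apply: (drop a).
  exists (fun i => (1 - c a)^-1 * c (lift a i)); split.
    by move=> i; rewrite mulr_ge0 ?invr_ge0 ?subr_ge0 // ltW.
  apply/funext => j; under eq_bigr do rewrite -mulrA.
  by rewrite -mulr_sumr -ca mulKf // subr_eq0 gt_eqF.
have ca1 : 1 - c a = 0.
  apply/eqP; rewrite eq_le; apply/andP; split; first by rewrite subr_le0.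
  by rewrite -(pmulr_lge0 _ (hv0 a)) hca; exact: sumr_ge0.
move=> i; have [i' ->|->] := unliftP a i; last first.
  by rewrite eqxx; apply/esym/eqP; rewrite -subr_eq0 ca1.
move: hca; rewrite ca1 mul0r => /esym/eqP; rewrite psumr_eq0 // => /allP /(_ i').
rewrite mem_index_enum [lift a i' == a]eq_sym (negPf (neq_lift _ _)) => /(_ isT) /=.
by rewrite mulf_eq0 (gt_eqF (hv0 _)) orbF => /eqP.
Qed.
End FinitelyGenerated.

(** * Vertices, edges and facets of a polyhedral cone *)

Section Slack.
Variable R : realType.

Lemma small_eps (I : finType) (p q : I -> R) :
  (forall i, 0 <= p i) -> (forall i, p i = 0 -> q i <= 0) ->
  exists e, 0 < e /\ forall i, e * q i <= p i.
Proof.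
(* The inverse of 0 being 0, indices with [p i = 0] contribute nothing to [S]. *)
move=> p0 q0; pose S := \sum_i `|q i| / p i.
have S0 : 0 <= S by apply: sumr_ge0 => i _; rewrite divr_ge0.
have S1 : 0 < 1 + S by rewrite ltr_wpDr.
exists (1 + S)^-1; split=> [|i]; first by rewrite invr_gt0.
have [pi0|pi0] := eqVneq (p i) 0.
  by rewrite pi0 mulr_ge0_le0 ?invr_ge0 ?(ltW S1) ?q0.
rewrite mulrC ler_pdivrMr // (le_trans (ler_norm _)) //.
have pi1 : 0 < p i by rewrite lt_def pi0 p0.
rewrite -ler_pdivrMl // mulrC (@le_trans _ _ S) ?lerDr //.
rewrite /S (bigD1 i) //= lerDl; apply: sumr_ge0 => j _.
by rewrite divr_ge0.
Qed.

(* The vertices y e of the base, normalised by phi (y e) = 1, the facets f b, and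
   the coefficients c s e of a decomposition of the reduction map; slack is the
   slack matrix of the base. *)
Variables (J E F : finType) (k' : nat).
Variables (y : E -> J -> R) (f : F -> J -> R) (phi : J -> R).
Notation k := k'.+1.
Definition slack b e := pairing (f b) (y e).
Local Notation P := slack.
Hypothesis P0 : forall b e, 0 <= P b e.
Hypothesis phiy : forall e, pairing phi (y e) = 1.
Hypothesis conef : forall x, (forall b, 0 <= pairing (f b) x) -> fg_cone y x.
Hypothesis sep_facets : forall b b', b != b' -> exists e, P b e = 0 /\ 0 < P b' e.
Hypothesis f_neq0 : forall b, exists e, 0 < P b e.
Hypothesis irr : irredundant y.

(** For small [e] both [y v + e z] and [y v - e z] satisfy all facet inequalities, and their mean is
    [y v]; irredundance puts them on the line of [y v]. *)
Lemma vertex_line v z :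
  (forall b, P b v = 0 -> pairing (f b) z = 0) ->
  exists s, z = (fun j => s * y v j).
Proof.
move=> hz.
have [e [e0 he]] := @small_eps _ (P^~ v) (fun b => `|pairing (f b) z|)
  (fun b => P0 b v) (fun b h => eq_ind_r (fun t => `|t| <= 0)
     (eq_ind_r (fun t => t <= 0) (lexx 0) (normr0 R)) (hz b h)).
have cz s : `|s| = e -> fg_cone y (fun j => 1 * y v j + s * z j).
  move=> hs; apply: conef => b; rewrite pairing_lin mul1r.
  have := he b; rewrite -hs -normrM ler_norml => /andP[h _].
  by rewrite -/(P b v); lra.
have [a [a0 ha]] := cz e (gtr0_norm e0).
have [a' [a'0 ha']] := cz (- e) (etrans (normrN e) (gtr0_norm e0)).
have hv : y v = (fun j => \sum_e' ((a e' + a' e') / 2) * y e' j).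
  apply/funext => j.
  have := congr1 (fun g => g j) ha; have := congr1 (fun g => g j) ha'; rewrite /= => h' h.
  transitivity ((\sum_e' a e' * y e' j + \sum_e' a' e' * y e' j) / 2).
    by rewrite -h -h'; lra.
  rewrite -big_split mulr_suml; apply: eq_bigr => e' _ /=; ring.
have aa' : forall e', (a e' + a' e') / 2 = (e' == v)%:R.
  by apply: irr hv => e'; rewrite divr_ge0 // addr_ge0.
have av e' : e' != v -> a e' = 0.
  move=> /negPf e'v; have := aa' e'; rewrite e'v /=.
  by have := a0 e'; have := a'0 e'; lra.
exists ((a v - 1) / e); apply/funext => j.
have := congr1 (fun g => g j) ha; rewrite /= (bigD1 v) //= big1 ?addr0; last first.
  by move=> e' /av ->; rewrite mul0r.
rewrite mul1r => h; have -> : z j = (e * z j) / e by rewrite mulrC mulKf // gt_eqF.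
by rewrite [RHS]mulrAC; apply: (congr1 (fun t => t / e)); lra.
Qed.

Lemma sum_delta (I : finType) (v : I) (g : I -> R) :
  \sum_e (e == v)%:R * g e = g v.
Proof.
rewrite (bigD1 v) //= eqxx mul1r big1 ?addr0 // => e /negPf ->.
by rewrite mul0r.
Qed.

Lemma irredundant2 u v w a b : 0 <= a -> 0 <= b ->
  (forall j, y u j = a * y v j + b * y w j) -> u = v \/ u = w.
Proof.
move=> a0 b0 hu.
have [uv|uv] := eqVneq u v; first by left.
have [uw|uw] := eqVneq u w; first by right.
have /(_ u) : forall e, a * (e == v)%:R + b * (e == w)%:R = (e == u)%:R.
  apply: irr => [e|]; first by rewrite addr_ge0 // mulr_ge0.
  apply/funext => j; rewrite hu -(sum_delta v (fun e => y e j)) -(sum_delta w (fun e => y e j)).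
  by rewrite !mulr_sumr -big_split; apply: eq_bigr => e _ /=; ring.
rewrite eqxx (negPf uv) (negPf uw) !mulr0 addr0 => /esym/eqP.
by rewrite oner_eq0.
Qed.

(** Subtracting a multiple of [y w] from [y u] makes [f b] vanish as well, so [vertex_line] gives
    [y u = al * y w + s * y v]. According to the sign of [s], either [u] or [w] is a nonnegative
    combination of the other two, and [irredundant2] applies. *)
Lemma edge_ends v w u b :
  0 < P b w -> P b v = 0 ->
  (forall b', P b' v = 0 -> b' != b -> P b' w = 0) ->
  (forall b', P b' v = 0 -> b' != b -> P b' u = 0) -> u = v \/ u = w.
Proof.
move=> bw bv hw hu.
have vw : w != v by apply/eqP => vw; move: bw; rewrite vw bv ltxx.
pose al := P b u / P b w.
have al0 : 0 <= al by rewrite divr_ge0 // ltW.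
have [s hs] : exists s, (fun j => 1 * y u j + (- al) * y w j) = (fun j => s * y v j).
  apply: vertex_line => b' b'v; rewrite pairing_lin mul1r -/(P b' u) -/(P b' w).
  have [->|b'b] := eqVneq b' b.
    by rewrite /al mulNr divfK ?subrr // gt_eqF.
  by rewrite hw // hu // mulr0 addr0.
have hsj j : y u j = al * y w j + s * y v j.
  by have := congr1 (fun g => g j) hs; rewrite /=; lra.
have [s0|s0] := leP 0 s; first by have [] := irredundant2 al0 s0 hsj; auto.
have al1 : 0 < al.
  rewrite lt_def al0 andbT; apply/eqP => al00.
  have : pairing phi (y u) = s.
    rewrite -[s]mulr1 -(phiy v) -pairing_scale; congr (pairing phi _).
    by apply/funext => j; rewrite hsj al00 mul0r add0r.
  by rewrite phiy; lra.
have [] := @irredundant2 w u v al^-1 (- s / al).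
- by rewrite invr_ge0.
- by rewrite divr_ge0 ?oppr_ge0 // ltW.
- by move=> j; rewrite hsj; field; rewrite gt_eqF.
- by right.
- by move=> wv; rewrite wv eqxx in vw.
Qed.

(** * Combinatorial consequences of a decomposition of the reduction map *)

Variable c : {ffun 'I_k -> F} -> E -> R.
Hypothesis c0 : forall s e, 0 <= c s e.

Definition weight e (xs : 'I_k -> J -> R) :=
  \sum_s c s e * \prod_l pairing (f (s l)) (xs l).

Hypothesis decomp : forall xs j, \sum_e weight e xs * y e j =
  k%:R^-1 * \sum_l (\prod_(l' | l' != l) pairing phi (xs l')) * xs l j.

Lemma decomp_pairing g xs : \sum_e weight e xs * pairing g (y e) =
  k%:R^-1 * \sum_l (\prod_(l' | l' != l) pairing phi (xs l')) * pairing g (xs l).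
Proof.
rewrite -!pairing_sumr -pairing_scale; congr (pairing g _).
by apply/funext => j; rewrite decomp.
Qed.

Lemma k_neq0 : k%:R != 0 :> R.
Proof. by rewrite pnatr_eq0. Qed.

Lemma decomp_diag x j : pairing phi x = 1 ->
  \sum_e weight e (fun _ => x) * y e j = x j.
Proof.
move=> h; rewrite decomp; under eq_bigr do rewrite big1 // mul1r.
by rewrite sumr_const card_ord -(mulr_natl (x j)) mulKf // k_neq0.
Qed.

Lemma weight_ge0 e (xs : 'I_k -> J -> R) :
  (forall l b, 0 <= pairing (f b) (xs l)) -> 0 <= weight e xs.
Proof.
move=> h; apply: sumr_ge0 => s _; rewrite mulr_ge0 //.
by apply: prodr_ge0.
Qed.

(** If [b] did not occur, each slot [l] could be fed a vertex lying on [b] but off [s l]. Applying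
    [f b] to the decomposition would give 0 on the right, while the term of [s] and [e] on the left
    is positive. *)
Lemma missed_facet_occurs s e b : 0 < c s e -> 0 < P b e -> exists l, s l = b.
Proof.
move=> cs Pb; have [[l /eqP hl]|hn] := pselect (exists l, s l == b); first by exists l.
have hsl l : b != s l by apply/eqP => bl; apply: hn; exists l; rewrite bl.
have /choice [e' he'] : forall l, exists e', P b e' = 0 /\ 0 < P (s l) e'.
  by move=> l; exact: sep_facets.
pose xs l := y (e' l).
have : \sum_e weight e xs * pairing (f b) (y e) = 0.
  rewrite decomp_pairing big1 ?mulr0 // => l _.
  by case: (he' l) => h _; rewrite /xs -/(P b _) h mulr0.
have w0 e1 : 0 <= weight e1 xs by apply: weight_ge0 => l b'; exact: P0.
move/eqP; rewrite psumr_eq0 => [/allP/(_ e)|e1 _]; last by rewrite mulr_ge0 ?P0.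
rewrite mem_index_enum => /(_ isT) /=; rewrite mulf_eq0 (gt_eqF Pb) orbF.
rewrite /weight psumr_eq0 => [/allP/(_ s)|s' _]; last first.
  by rewrite mulr_ge0 // prodr_ge0 // => l _; exact: P0.
rewrite mem_index_enum => /(_ isT) /=; rewrite gt_eqF // mulr_gt0 // prodr_gt0 // => l _.
by case: (he' l).
Qed.

Lemma card_missed_facets v : (#|[pred b | P b v != 0%R]| <= k)%N.
Proof.
(* Fed with [y v] in all slots, the decomposition returns [y v]; irredundance then forces weight 1
   at [v]. *)
have : exists s, 0 < c s v.
  apply: contrapT => /forallNP hs.
  have /(_ v) : forall e, weight e (fun _ => y v) = (e == v)%:R.
    apply: irr => [e|]; first by apply: weight_ge0 => l b; exact: P0.
    by apply/funext => j; rewrite decomp_diag.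
  rewrite eqxx /weight big1 => [/esym/eqP|s _]; first by rewrite oner_eq0.
  have /negP := hs s; rewrite -leNgt => h.
  by rewrite (_ : c s v = 0) ?mul0r //; apply/eqP; rewrite eq_le h c0.
case=> s cs; rewrite -[k in (_ <= k)%N]card_ord.
apply: leq_trans (leq_image_card s predT).
apply: subset_leq_card; apply/fintype.subsetP => b; rewrite inE => Pb.
have [|l <-] := missed_facet_occurs cs (b := b); first by rewrite lt_def Pb P0.
exact: codom_f.
Qed.

(** The vertex [v] occupies all slots but the first. As [f b] vanishes at [v], a first argument off
    [b] gives positive weight to some vertex [w] off [b]; in a term [s] responsible for this,
    [s ord0] is the only facet through [v] that can miss [w]. *)
Lemma neighbour v b : P b v = 0 -> exists w, 0 < P b w /\
  forall b', P b' v = 0 -> b' != b -> P b' w = 0.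
Proof.
move=> bv; have [e1 be1] := f_neq0 b.
pose xs x (l : 'I_k) := if l == ord0 then x else y v.
have H x : \sum_e weight e (xs x) * P b e = k%:R^-1 * pairing (f b) x.
  rewrite decomp_pairing; congr (_ * _); rewrite big_ord_recl.
  rewrite [X in _ + X]big1 => [|l _]; last by rewrite /xs /= -/(P b v) bv mulr0.
  by rewrite addr0 big1 ?mul1r // => l /negPf l0; rewrite /xs l0.
have xs0 e l b' : 0 <= pairing (f b') (xs (y e) l) by rewrite /xs; case: ifP => _; exact: P0.
have [w hw] : exists w, 0 < weight w (xs (y e1)) * P b w.
  apply: contrapT => /forallNP hn; have := H (y e1).
  rewrite big1 => [/esym/eqP|e _].
    by rewrite mulf_eq0 invr_eq0 (negPf k_neq0) gt_eqF.
  apply/eqP; rewrite eq_le mulr_ge0 ?P0 ?weight_ge0 // andbT leNgt.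
  exact/negP.
have bw : 0 < P b w.
  by rewrite lt_def P0 andbT; apply: contraTN hw => /eqP ->; rewrite mulr0 ltxx.
have [s hs] : exists s, 0 < c s w * \prod_l pairing (f (s l)) (xs (y e1) l).
  apply: contrapT => /forallNP hn.
  suff : weight w (xs (y e1)) = 0 by move=> h; rewrite h mul0r ltxx in hw.
  rewrite /weight big1 // => s _; apply/eqP; rewrite eq_le.
  by rewrite mulr_ge0 ?c0 ?prodr_ge0 // andbT leNgt; apply/negP.
have cs : 0 < c s w.
  by rewrite lt_def c0 andbT; apply: contraTN hs => /eqP ->; rewrite mul0r ltxx.
have fs l : l != ord0 -> 0 < pairing (f (s l)) (y v).
  move=> /negPf l0; rewrite lt_def P0 andbT; apply: contraTN hs => /eqP h.
  by rewrite (bigD1 l) //= /xs l0 h mul0r mulr0 ltxx.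
(* Otherwise a vertex on [b'] but off [s ord0], put in the first slot, places all arguments on [b']
   and still gives positive weight to [w]. *)
have first_slot b' : P b' v = 0 -> 0 < P b' w -> s ord0 = b'.
  move=> b'v b'w; apply/eqP; apply: contraT; rewrite eq_sym => /sep_facets[e [b'e se]].
  have H' : \sum_e' weight e' (xs (y e)) * P b' e' = 0.
    rewrite decomp_pairing big1 ?mulr0 // => l _.
    by rewrite /xs; case: ifP => _; rewrite -/(P b' _) ?b'v ?b'e mulr0.
  move/eqP: H'; rewrite psumr_eq0 => [/allP/(_ w)|e' _]; last first.
    by rewrite mulr_ge0 ?P0 ?weight_ge0.
  rewrite mem_index_enum => /(_ isT) /=; rewrite mulf_eq0 (gt_eqF b'w) orbF.
  rewrite /weight psumr_eq0 => [/allP/(_ s)|s' _]; last first.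
    by rewrite mulr_ge0 // prodr_ge0.
  rewrite mem_index_enum => /(_ isT) /=; rewrite gt_eqF // mulr_gt0 // prodr_gt0 // => l _.
  by rewrite /xs; have [->//|/fs] := eqVneq l ord0.
exists w; split=> // b' b'v b'b; apply/eqP; rewrite eq_le P0 andbT leNgt.
by apply: contraNN b'b => /(first_slot _ b'v) <-; rewrite (first_slot b).
Qed.

(* The weight of w along the edge is the polynomial t, but every term of it
   contains the affine function b2, which would bring in a second root. *)
Lemma parallel_along_edge v w b b2 :
  P b v = 0 -> 0 < P b w -> (forall b', P b' v = 0 -> b' != b -> P b' w = 0) ->
  0 < P b2 v -> 0 < P b2 w -> P b2 v = P b2 w.
Proof.
move=> bv bw hw b2v b2w.
pose x t j := (1 - t) * y v j + t * y w j.
have xE g t : pairing g (x t) = (1 - t) * pairing g (y v) + t * pairing g (y w).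
  exact: pairing_lin.
have x0 t : 0 <= t <= 1 -> forall b', 0 <= pairing (f b') (x t).
  move=> /andP[t0 t1] b'; rewrite xE addr_ge0 // mulr_ge0 ?P0 ?subr_ge0 //; exact: P0.
have D g t : \sum_e weight e (fun _ => x t) * pairing g (y e) = pairing g (x t).
  rewrite -pairing_sumr; congr (pairing g _); apply/funext => j.
  by rewrite decomp_diag // xE !phiy; ring.
(* The facets through [v] other than [b] vanish on the edge, so only [v] and [w] can carry weight,
   by [edge_ends]; [f b], zero at [v], then reads off the weight of [w]. *)
have weight_t t : 0 <= t <= 1 -> weight w (fun _ => x t) = t.
  move=> t01; apply: (mulIf (lt0r_neq0 bw)).
  have := D (f b) t; rewrite xE -!/(P b _) bv mulr0 add0r => <-.
  rewrite (bigD1 w) //= big1 ?addr0 // => e ew; apply/eqP; rewrite mulf_eq0.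
  apply/orP; have [ev|ev] := eqVneq e v; first by right; rewrite ev -/(P b v) bv.
  have [b' [b'v b'b b'e]] : exists b', [/\ P b' v = 0, b' != b & P b' e != 0].
    apply: contrapT => /forallNP hn.
    have [] := @edge_ends v w e b bw bv hw.
    - move=> b' b'v b'b; apply/eqP; apply: contraT => b'e.
      by case: (hn b').
    - by move=> h; rewrite h eqxx in ev.
    - by move=> h; rewrite h eqxx in ew.
  left; have := D (f b') t; rewrite xE -!/(P b' _) b'v (hw _ b'v b'b) !mulr0 addr0.
  move/eqP; rewrite psumr_eq0 => [/allP/(_ e)|e' _]; last first.
    by rewrite mulr_ge0 ?P0 // weight_ge0 // => _; exact: x0.
  by rewrite mem_index_enum mulf_eq0 (negPf b'e) orbF => /(_ isT).
pose q : {poly R} := \sum_s c s w *: \prod_l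
  ((1 - 'X) * (P (s l) v)%:P + 'X * (P (s l) w)%:P).
have qE t : q.[t] = weight w (fun _ => x t).
  rewrite /q horner_sum; apply: eq_bigr => s _; rewrite hornerZ horner_prod.
  congr (_ * _); apply: eq_bigr => l _; by rewrite xE !hornerE.
have qX : q = 'X.
  apply/eqP; rewrite -subr_eq0; apply/eqP.
  (* The identity is known on [0, 1] only; the points [1 / (n + 1)] supply as many roots as the size
     of the polynomial. *)
  pose r n : R := n.+1%:R^-1.
  apply: (@roots_geq_poly_eq0 _ _ [seq r n | n <- iota 0 (size (q - 'X))]).
  - apply/allP => _ /mapP[n _ ->]; rewrite /root !hornerE qE weight_t ?subrr //.
    by rewrite /r invr_ge0 ler0n invf_le1 ?ltr0n // ler1n.
  - rewrite map_inj_uniq ?iota_uniq // => n m /invr_inj /eqP.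
    by rewrite eqr_nat eqSS => /eqP.
  - by rewrite size_map size_iota.
apply/eqP; rewrite -subr_eq0; apply: contraT => d0.
(* The zero of [f b2] on the line of the edge. It lies outside [0, 1], where only the polynomial
   identity is available. *)
pose t := P b2 v / (P b2 v - P b2 w).
have : q.[t] = 0.
  rewrite qE /weight big1 // => s _.
  have [->|cs] := eqVneq (c s w) 0; first by rewrite mul0r.
  have [|l sl] := @missed_facet_occurs s w b2 _ b2w; first by rewrite lt_def cs c0.
  rewrite (bigD1 l) //= sl xE -!/(P b2 _) (_ : (1 - t) * _ + _ = 0) ?mul0r ?mulr0 //.
  by rewrite /t; field.
rewrite qX hornerX => /eqP; rewrite mulf_eq0 invr_eq0 (negPf d0) orbF.
by rewrite gt_eqF.
Qed.

(** Otherwise every facet missing [v] also misses [w], hence is constant along the edge, and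
    [y w - y v] lies in the cone; since [phi] vanishes on it, it is zero. *)
Lemma exchanged_facet v w b :
  P b v = 0 -> 0 < P b w -> (forall b', P b' v = 0 -> b' != b -> P b' w = 0) ->
  exists b2, 0 < P b2 v /\ P b2 w = 0.
Proof.
move=> bv bw hw; apply: contrapT => /forallNP hn.
have [a [a0 ha]] : fg_cone y (fun j => 1 * y w j + (- 1) * y v j).
  apply: conef => b'; rewrite pairing_lin -!/(P b' _) mul1r mulN1r subr_ge0.
  have [b'v|b'v] := eqVneq (P b' v) 0; first by rewrite b'v P0.
  have b'v0 : 0 < P b' v by rewrite lt_def b'v P0.
  have [b'w|b'w] := eqVneq (P b' w) 0; first by case: (hn b').
  by rewrite (parallel_along_edge bv bw hw (b2 := b')) // lt_def b'w P0.
have /eqP : \sum_e a e = 0.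
  transitivity (pairing phi (fun j => 1 * y w j + (- 1) * y v j)).
    by rewrite ha pairing_sumr; apply: eq_bigr => e _; rewrite phiy mulr1.
  by rewrite pairing_lin !phiy; ring.
rewrite psumr_eq0 // => /allP h.
have wv : y w = y v.
  apply/funext => j; have := congr1 (fun g => g j) ha.
  rewrite /= big1 => [|e _]; first lra.
  by have /eqP -> := h e (mem_index_enum _); rewrite mul0r.
by move: bw; rewrite /P wv -/(P b v) bv ltxx.
Qed.

(** The edge leaving [w] off [b2] leads to a vertex [u] on all other facets through [w], so [u] is
    an end of the edge from [v] to [w]. If [b3] differs from [b2], it contains [u], which excludes
    [u = v], while [b2] excludes [u = w]. *)
Lemma exchanged_facet_uniq v w b b2 b3 :
  P b v = 0 -> 0 < P b w -> (forall b', P b' v = 0 -> b' != b -> P b' w = 0) ->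
  0 < P b2 v -> P b2 w = 0 -> 0 < P b3 v -> P b3 w = 0 -> b2 = b3.
Proof.
move=> bv bw hw b2v b2w b3v b3w; apply/eqP; apply: contraT => b23.
have [u [b2u hu]] := neighbour b2w.
have [] := @edge_ends v w u b bw bv hw.
- move=> b' b'v b'b; apply: hu; first exact: hw.
  by apply: contraTneq b2v => <-; rewrite b'v ltxx.
- by move=> uv; move: b3v; rewrite -uv hu ?ltxx // eq_sym.
- by move=> uw; move: b2u; rewrite uw b2w ltxx.
Qed.

(** * Simplex coordinates at a vertex *)

Lemma sum_sigma (r : nat) (d : 'I_r -> nat) (G : {i : 'I_r & 'I_(d i).+1} -> R) :
  \sum_p G p = \sum_i (G (@Tagged _ i (fun i => 'I_(d i).+1) ord0) +
    \sum_(j < d i) G (@Tagged _ i (fun i => 'I_(d i).+1) (lift ord0 j))).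
Proof.
transitivity (\sum_(i < r) \sum_(j < (d i).+1) G (@Tagged _ i (fun i => 'I_(d i).+1) j)).
  by rewrite sig_big_dep /=; apply: eq_bigr => -[i j] _.
by apply: eq_bigr => i _; rewrite big_ord_recl.
Qed.

(** [W b] is the other end of the edge leaving [v] off [b], and [N b] the facet gained there. Facets
    missing [v] index the factors; the block of such a facet is its fibre under [N], an empty fibre
    giving a point. *)
Lemma product_of_simplices (v : E) : exists (r : nat) (d : 'I_r -> nat),
  (r <= k)%N /\ affinely_equivalent (K_phi (fg_cone y) phi) (simplex_prod d).
Proof.
have /choice [W hW] : forall b, exists w, P b v = 0 ->
    0 < P b w /\ forall b', P b' v = 0 -> b' != b -> P b' w = 0.
  move=> b; have [/neighbour[w hw]|/eqP h] := eqVneq (P b v) 0; last by exists v.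
  by exists w.
have /choice [N hN] : forall b, exists b2, P b v = 0 -> 0 < P b2 v /\ P b2 (W b) = 0.
  move=> b; have [bv|/eqP h] := eqVneq (P b v) 0; last by exists b.
  have [bw hw] := hW b bv; have [b2 h2] := exchanged_facet bv bw hw.
  by exists b2.
have PW g b : P b v = 0 -> 0 < P g v -> P g (W b) - P g v = - (g == N b)%:R * P g v.
  move=> bv gv; have [bw hw] := hW b bv; have [Nv Nw] := hN b bv.
  have [->|gN] := eqVneq g (N b); first by rewrite Nw mulN1r sub0r.
  rewrite oppr0 mul0r (parallel_along_edge bv bw hw gv) ?subrr // lt_def P0 andbT.
  apply: contraNneq gN => gw; apply/eqP.
  exact: (exchanged_facet_uniq bv bw hw).
pose lam b x := pairing (f b) x / P b (W b).
pose r := #|[pred b | P b v != 0%R]|.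
pose mi (i : 'I_r) : F := enum_val i.
have miv i : 0 < P (mi i) v.
  by rewrite lt_def P0 andbT; have := enum_valP i; rewrite inE.
pose B (i : 'I_r) := [pred b | (P b v == 0%R) && (N b == mi i)].
pose d i := #|B i|.
pose bij i (j : 'I_(d i)) : F := enum_val j.
have bijP i (j : 'I_(d i)) : P (bij i j) v = 0 /\ N (bij i j) = mi i.
  by have := enum_valP j; rewrite inE => /andP[/eqP h /eqP h'].
have bij_surj b : P b v = 0 -> exists i (j : 'I_(d i)), b = bij i j.
  move=> bv; have [Nv _] := hN b bv.
  have hM : N b \in [pred b | P b v != 0%R] by rewrite inE gt_eqF.
  have hB : b \in B (enum_rank_in hM (N b)).
    by rewrite inE bv eqxx /mi enum_rankK_in /=.
  by exists (enum_rank_in hM (N b)), (enum_rank_in hB b); rewrite /bij enum_rankK_in.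
have sumZ (G : F -> R) :
    \sum_(b | P b v == 0) G b = \sum_i \sum_(j < d i) G (bij i j).
  rewrite (partition_big N (mem [pred b | P b v != 0%R])) => [|b /eqP bv]; last first.
    by rewrite !inE gt_eqF //; case: (hN b bv).
  rewrite big_enum_val; apply: eq_bigr => i _.
  by rewrite -(big_enum_val (A := B i) G); apply: eq_bigl => b; rewrite !inE.
(* Subtracting the vertices [W b] with coefficients [lam b x] makes every facet through [v] vanish,
   so a multiple of [y v] remains; [phi] determines the factor. *)
have expand x : pairing phi x = 1 -> x =
    (fun q => y v q + \sum_(b | P b v == 0) lam b x * (y (W b) q - y v q)).
  move=> phix.
  pose a b := if P b v == 0 then lam b x else 0.
  have [s hs] : exists s, (fun j => 1 * x j + (- 1) * \sum_b a b * y (W b) j) =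
      (fun j => s * y v j).
    apply: vertex_line => b bv; rewrite pairing_lin pairing_sumr (bigD1 b) //= big1.
      have [bw _] := hW b bv.
      by rewrite -/(P b (W b)) /a bv eqxx /lam divfK ?gt_eqF //; ring.
    move=> b' b'b; rewrite /a; case: ifP => [/eqP b'v|_]; last by rewrite mul0r.
    have [_ hw] := hW b' b'v.
    by rewrite -/(P b _) hw ?mulr0 // eq_sym.
  have sE : s = 1 - \sum_b a b.
    transitivity (pairing phi (fun j => s * y v j)).
      by rewrite pairing_scale phiy mulr1.
    rewrite -hs pairing_lin pairing_sumr phix; congr (_ + _); first by rewrite mulr1.
    by rewrite mulN1r; congr (- _); apply: eq_bigr => b _; rewrite phiy mulr1.
  apply/funext => q; have := congr1 (fun g => g q) hs; rewrite /= sE => h.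
  rewrite [in RHS]big_mkcond (eq_bigr (fun b => a b * y (W b) q - a b * y v q)).
    by rewrite sumrB -mulr_suml; lra.
  by move=> b _; rewrite /a; case: ifP => _; rewrite ?mul0r ?subrr // mulrBr.
have missed x i : pairing phi x = 1 ->
    pairing (f (mi i)) x = P (mi i) v * (1 - \sum_(j < d i) lam (bij i j) x).
  move=> phix; rewrite {1}(expand x phix).
  have -> : (fun q => y v q + \sum_(b | P b v == 0) lam b x * (y (W b) q - y v q)) =
     (fun q => 1 * y v q + 1 * \sum_b (if P b v == 0 then lam b x else 0) *
        (1 * y (W b) q + (- 1) * y v q)).
    apply/funext => q; rewrite !mul1r big_mkcond; congr (_ + _).
    by apply: eq_bigr => b _; case: ifP => _; rewrite ?mul0r // mul1r mulN1r.
  rewrite pairing_lin pairing_sumr !mul1r -/(P _ v) mulrBr mulr1; congr (_ + _).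
  rewrite -(big_enum_val (A := B i) (fun b => lam b x)).
  rewrite [in RHS]big_mkcond [in RHS]mulr_sumr -[in RHS]sumrN; apply: eq_bigr => b _.
  rewrite !inE; have [bv|_] := eqVneq (P b v) 0; last by rewrite mul0r mulr0 oppr0.
  rewrite pairing_lin mul1r mulN1r PW // eq_sym; case: eqP => _ /=; ring.
(* In each block, index [ord0] carries the facet missing [v], scaled to be 1 at [v]; the lifted
   indices carry the coordinates [lam]. *)
pose row (p : {i : 'I_r & 'I_(d i).+1}) : J -> R :=
  if unlift ord0 (tagged p) is Some j
  then fun q => (P (bij _ j) (W (bij _ j)))^-1 * f (bij _ j) q
  else fun q => (P (mi (tag p)) v)^-1 * f (mi (tag p)) q.
pose T (x : J -> R) p := \sum_q row p q * x q + 0.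
(* On the product of simplices the coordinate at [ord0] is 1 minus the rest of its block, so the
   inverse map can ignore it. *)
pose col q (p : {i : 'I_r & 'I_(d i).+1}) : R :=
  if unlift ord0 (tagged p) is Some j then y (W (bij _ j)) q - y v q else 0.
pose S (s : {i : 'I_r & 'I_(d i).+1} -> R) q := \sum_p col q p * s p + y v q.
have Tlift x i j : T x (@Tagged _ i (fun i => 'I_(d i).+1) (lift ord0 j)) = lam (bij i j) x.
  rewrite /T addr0 /row /= liftK -/(pairing _ x) pairingC pairing_scale.
  by rewrite pairingC mulrC.
have T0 x i : T x (@Tagged _ i (fun i => 'I_(d i).+1) ord0) =
    pairing (f (mi i)) x / P (mi i) v.
  rewrite /T addr0 /row /= unlift_none -/(pairing _ x) pairingC pairing_scale.
  by rewrite pairingC mulrC.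
have SE s q : S s q = y v q + \sum_i \sum_(j < d i)
    s (@Tagged _ i (fun i => 'I_(d i).+1) (lift ord0 j)) * (y (W (bij i j)) q - y v q).
  rewrite /S addrC sum_sigma; congr (_ + _); apply: eq_bigr => i _.
  rewrite {1}/col /= unlift_none mul0r add0r; apply: eq_bigr => j _.
  by rewrite /col /= liftK mulrC.
have pS g s : pairing g (S s) = pairing g (y v) + \sum_i \sum_(j < d i)
    s (@Tagged _ i (fun i => 'I_(d i).+1) (lift ord0 j)) *
      (pairing g (y (W (bij i j))) - pairing g (y v)).
  transitivity (pairing g (fun q => 1 * (\sum_p s p * col q p) + 1 * y v q)).
    congr (pairing g _); apply/funext => q; rewrite !mul1r; congr (_ + _).
    by apply: eq_bigr => p _; rewrite mulrC.
  rewrite pairing_lin (pairing_sumr g s (fun p q => col q p)) !mul1r addrC; congr (_ + _).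
  rewrite sum_sigma; apply: eq_bigr => i _.
  rewrite (_ : (fun q => col q _) = (fun _ => 0)); last first.
    by apply/funext => q; rewrite /col /= unlift_none.
  rewrite pairing0 mulr0 add0r; apply: eq_bigr => j _; congr (_ * _).
  rewrite -[pairing g (y (W _))]mul1r -mulN1r -pairing_lin; congr (pairing g _).
  by apply/funext => q; rewrite /col /= liftK mul1r mulN1r.
have ST x : pairing phi x = 1 -> S (T x) = x.
  move=> phix; rewrite [RHS](expand x phix); apply/funext => q.
  rewrite SE sumZ; congr (_ + _); apply: eq_bigr => i _; apply: eq_bigr => j _.
  by rewrite Tlift.
have phiS s : pairing phi (S s) = 1.
  rewrite pS phiy big1 ?addr0 // => i _; rewrite big1 // => j _.
  by rewrite !phiy subrr mulr0.
have lamS s i j : lam (bij i j) (S s) = s (@Tagged _ i (fun i => 'I_(d i).+1) (lift ord0 j)).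
  have [bv bN] := bijP i j; have [bw hw] := hW _ bv.
  rewrite /lam pS -/(P _ v) bv add0r; apply: (canLR (mulfK (lt0r_neq0 bw))).
  have other i' (j' : 'I_(d i')) : bij i j != bij i' j' -> P (bij i j) (W (bij i' j')) = 0.
    move=> ne; have [b'v _] := bijP i' j'; have [_ h] := hW _ b'v.
    exact: h.
  rewrite (bigD1 i) //= (bigD1 j) //= subr0 [X in _ + X + _]big1 => [|j' j'j].
    rewrite big1 ?addr0 // => i' i'i; rewrite big1 // => j' _.
    rewrite -!/(P (bij i j) _) other ?subr0 ?mulr0 //; apply: contraNneq i'i => e.
    by have [_] := bijP i' j'; rewrite -e bN => /enum_val_inj ->.
  rewrite -!/(P (bij i j) _) other ?subr0 ?mulr0 //; apply: contraNneq j'j.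
  by move/enum_val_inj => ->.
have PS s : simplex_prod d s -> K_phi (fg_cone y) phi (S s) /\ T (S s) = s.
  move=> [s0 s1].
  have m0 i : pairing (f (mi i)) (S s) =
      P (mi i) v * s (@Tagged _ i (fun i => 'I_(d i).+1) ord0).
    rewrite missed // -(s1 i) big_ord_recl; congr (_ * _).
    by rewrite (eq_bigr _ (fun j _ => lamS s i j)) addrK.
  split; first split=> //.
    apply: conef => b; have [bv|bv] := eqVneq (P b v) 0.
      have [i [j bE]] := bij_surj b bv; have [bw _] := hW _ bv.
      have := lamS s i j; rewrite -bE => /(canRL (divfK (lt0r_neq0 bw))) ->.
      by rewrite mulr_ge0 // ltW.
    have hM : b \in [pred b | P b v != 0%R] by rewrite inE.
    rewrite -[b](enum_rankK_in hM hM) -/(mi _) m0 mulr_ge0 //; exact: P0.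
  apply/funext => -[i j]; have [j' ->|->] := unliftP ord0 j.
    by rewrite Tlift lamS.
  by rewrite T0 m0 mulrC mulKf // gt_eqF.
have KT x : K_phi (fg_cone y) phi x -> simplex_prod d (T x).
  move=> [[a [a0 xE]] phix].
  have fx b : 0 <= pairing (f b) x.
    by rewrite xE pairing_sumr; apply: sumr_ge0 => e _; rewrite mulr_ge0 // P0.
  split=> [[i j]|i].
    have [j' ->|->] := unliftP ord0 j; last by rewrite T0 divr_ge0 // ltW.
    by rewrite Tlift divr_ge0.
  rewrite big_ord_recl T0 missed // mulrC mulKf ?gt_eqF //.
  by rewrite (eq_bigr _ (fun j _ => Tlift x i j)) subrK.
exists r, d; split; first exact: card_missed_facets.
exists T, S; split; first split.
- by exists (fun p q => row p q), (fun _ => 0).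
- by exists col, (y v).
- apply/seteqP; split=> [_ [x Kx <-]|s Ps]; first exact: KT.
  by have [Ks TS] := PS s Ps; exists (S s).
- apply/seteqP; split=> [_ [s Ps <-]|x Kx]; first by have [] := PS s Ps.
  by exists (T x); [exact: KT|case: Kx => _ /ST].
- by split=> [x [_ /ST]|s /PS[]].
Qed.
End Slack.

(** * Closedness, the bipolar theorem and interior points *)

Section Topology.
Variable R : realType.

Lemma continuous_sum_coord (I : finType) (g : I -> R -> R) :
  (forall i, continuous (g i)) ->
  continuous (fun d : {ptws I -> R} => \sum_i g i (d i)).
Proof.
move=> gc; apply: continuous_big; first exact: add_continuous.
move=> i _ d; apply: (continuous_comp (f := fun d : {ptws I -> R} => d i)).
  exact: (@proj_continuous I (fun _ => R) i).
exact: gc.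
Qed.

Lemma pairing_continuous (I : finType) (f : I -> R) :
  continuous (fun d : {ptws I -> R} => pairing f d).
Proof.
by apply: (continuous_sum_coord (g := fun i t => f i * t)) => i; exact: mulrl_continuous.
Qed.

Lemma dual_cone_closed (I : finType) (C : set (I -> R)) : closed_vset (dual_cone C).
Proof.
rewrite /closed_vset (_ : dual_cone C = \bigcap_(x in C) [set f | 0 <= pairing x f]).
  apply: closed_bigI => x _.
  have /continuous_closedP/(_ _ (@closed_ge R 0)) := @pairing_continuous I x.
  exact.
by apply/seteqP; split=> f hf x Cx; have := hf x Cx; rewrite /= pairingC.
Qed.

Lemma linear_coef_ge0 (a b : R) :
  (forall t : R, 0 < t -> t <= 1 -> 0 <= a * t + b * t ^+ 2) -> 0 <= a.
Proof.
move=> h; rewrite leNgt; apply/negP => a0.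
have D : 0 < 1 - a + `|b| by rewrite ltr_wpDr // subr_gt0 (lt_trans a0).
(* Chosen so that [t <= 1] and [b * t < - a], which makes [a + b * t] negative. *)
pose t := - a / (1 - a + `|b|).
have t0 : 0 < t by rewrite divr_gt0 // oppr_gt0.
have t1 : t <= 1 by rewrite ler_pdivrMr // mul1r; have := normr_ge0 b; lra.
have : 0 <= (a + b * t) * t by have := h t t0 t1; congr (_ <= _); ring.
rewrite pmulr_lge0 // leNgt => /negP; apply.
have : b * t <= `|b| * t by rewrite ler_wpM2r ?ler_norm // ltW.
suff : `|b| * t < - a by lra.
rewrite /t mulrCA gtr_pMr ?oppr_gt0 // ltr_pdivrMr // mul1r; lra.
Qed.

(** Let [d] be a point of [C] nearest to [x]. Minimality puts [z = d - x] in the dual cone and gives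
    [pairing z d <= 0]; with [pairing z x >= 0] this forces [z = 0]. *)
Lemma bipolar (I : finType) (C : set (I -> R)) (x : I -> R) :
  convex_cone C -> closed_vset C ->
  (forall f, dual_cone C f -> 0 <= pairing f x) -> C x.
Proof.
move=> [C0 CD CZ] clC hx.
pose dist (d : {ptws I -> R}) := \sum_i (d i - x i) ^+ 2.
(* Outside the compact box of this radius, points are farther from [x] than the origin: a deviation
   above [rho >= 1] in one coordinate has square above [rho]. *)
pose rho := 1 + dist (fun _ => 0).
have dist_ge0 d : 0 <= dist d by apply: sumr_ge0 => i _; rewrite sqr_ge0.
have rho1 : 1 <= rho by rewrite lerDl.
have rho0 : 0 < rho by apply: lt_le_trans rho1.
pose box : set {ptws I -> R} := [set d | forall i, `[x i - rho, x i + rho]%classic (d i)].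
have cbox : compact box.
  exact: (@tychonoff I (fun _ => R) (fun i => `[x i - rho, x i + rho]%classic)
    (fun i => @segment_compact _ _ _)).
have far d : ~ box d -> dist (fun _ => 0) < dist d.
  move/existsNP => [i /=]; rewrite in_itv /= => /negP.
  rewrite -ler_distl -ltNge => hi.
  apply: (@lt_le_trans _ _ rho); first by rewrite ltrDr.
  rewrite /dist (bigD1 i) //= (@le_trans _ _ ((d i - x i) ^+ 2)) //; last first.
    by rewrite lerDl; apply: sumr_ge0 => j _; rewrite sqr_ge0.
  rewrite -real_normK ?num_real // expr2.
  by rewrite (le_trans (ltW hi)) // ler_peMl // ltW // (le_lt_trans rho1).
have ne : (C `&` box : set {ptws I -> R}) !=set0.
  by exists (fun _ => 0); split=> //; apply: contrapT => /far; rewrite ltxx.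
have cC : compact (C `&` box : set {ptws I -> R}).
  by rewrite setIC; exact: compact_closedI.
have dc : continuous dist.
  apply: (continuous_sum_coord (g := fun i t => (t - x i) ^+ 2)) => i t.
  apply: (@continuousM _ _ (fun t => t - x i) (fun t => t - x i)).
    by apply: continuousB; [exact: cvg_id|exact: cvg_cst].
  by apply: continuousB; [exact: cvg_id|exact: cvg_cst].
have [d /set_mem[Cd bd] dmin] := compact_EVT_min ne cC (continuous_subspaceT dc).
have {}dmin c : C c -> dist d <= dist c.
  move=> Cc; have [bc|/far bc] := pselect (box c); first by apply: dmin; rewrite inE.
  rewrite ltW // (le_lt_trans _ bc) //; apply: dmin; rewrite inE; split=> //.
  by apply: contrapT => /far; rewrite ltxx.
pose z : I -> R := fun i => 1 * d i + (- 1) * x i.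
have step (c : I -> R) (s t : R) : dist (fun i => s * d i + t * c i) = dist d
   + (2 * t * pairing z c + 2 * (s - 1) * pairing z d)
   + pairing (fun i => (s - 1) * d i + t * c i) (fun i => (s - 1) * d i + t * c i).
  rewrite /dist /pairing !mulr_sumr -!big_split; apply: eq_bigr => i _ /=.
  rewrite /z; ring.
have zdual : dual_cone C z.
  move=> c Cc; rewrite -(pmulr_rge0 _ (@ltr0n R 2)).
  apply: (@linear_coef_ge0 _ (pairing c c)) => t t0 t1.
  have /dmin : C (fun i => 1 * d i + t * c i).
    by apply: CD; apply: CZ => //; exact: ltW.
  rewrite step (_ : (fun i => (1 - 1) * d i + t * c i) = (fun i => t * c i)); last by apply/funext => i; ring.
  by rewrite pairing_scale pairing_scalel; lra.
have zd : pairing z d <= 0.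
  rewrite -oppr_ge0 -(pmulr_rge0 _ (@ltr0n R 2)).
  apply: (@linear_coef_ge0 _ (pairing d d)) => t t0 t1.
  have /dmin : C (fun i => (1 - t) * d i + 0 * d i).
    by apply: CD; apply: CZ => //; rewrite subr_ge0.
  rewrite step (_ : (fun i => (1 - t - 1) * d i + 0 * d i) = (fun i => - t * d i)); last by apply/funext => i; ring.
  by rewrite pairing_scale pairing_scalel; lra.
have zz : pairing z z <= 0.
  by rewrite {2}/z pairing_lin mul1r mulN1r; have := hx z zdual; lra.
suff -> : x = d by [].
apply/funext => i; have := congr1 (fun g => g i) (pairing_self_eq0 zz).
by rewrite /z /=; lra.
Qed.

Lemma interior_line (I : finType) (D : set (I -> R)) (f g : I -> R) :
  interior_vset D f -> exists2 t, 0 < t & D (fun i => f i + t * g i).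
Proof.
move=> hD.
have : (fun t : R => (fun i => f i + t * g i) : {ptws I -> R}) @ (0 : R) --> (f : {ptws I -> R}).
  apply/cvg_sup; first exact: (fmap_filter _ (nbhs_filter (0 : R))).
  move=> i U [V] [[W] oW <-] WfN WU; apply: (filterS WU).
    exact: (fmap_filter _ (nbhs_filter (0 : R))).
  have : (fun t : R => f i + t * g i) @ (0 : R) --> f i.
    rewrite -[X in _ --> X]addr0 -[X in _ + X](mul0r (g i)).
    by apply: cvgD; [exact: cvg_cst | apply: cvgM; [exact: cvg_id|exact: cvg_cst]].
  by move=> /(_ W (open_nbhs_nbhs (conj oW WfN))).
move=> /(_ _ hD) /=; rewrite !nbhs_simpl => -[e /= e0 he].
have e2 : 0 < e / 2 by rewrite divr_gt0.
exists (e / 2) => //; apply: he => /=.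
by rewrite sub0r normrN gtr0_norm // ltr_pdivrMr // ltr_pMr // ltr1n.
Qed.

End Topology.

(** * Product tensors, and the reduction map as a family of linear forms *)

Section Tensors.
Variable R : realType.

Lemma pairing_multitensor (J : finType) k (fs xs : 'I_k -> J -> R) :
  pairing (multitensor fs) (multitensor xs) = \prod_l pairing (fs l) (xs l).
Proof.
rewrite /pairing (bigA_distr_bigA (fun l j => fs l j * xs l j)).
by apply: eq_bigr => t _; rewrite -big_split.
Qed.

Lemma multitensor_sum (J I : finType) k (c : 'I_k -> I -> R) (f : I -> J -> R) :
  multitensor (fun l j => \sum_b c l b * f b j) =
  (fun t => \sum_(s : {ffun 'I_k -> I})
     (\prod_l c l (s l)) * multitensor (fun l => f (s l)) t).
Proof.
apply/funext => t.
rewrite /multitensor (bigA_distr_bigA (fun l b => c l b * f b (t l))).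
by apply: eq_bigr => s _; rewrite big_split.
Qed.

Definition slot_fun (J : finType) k (x y : J -> R) (l l' : 'I_k) : J -> R :=
  if l' == l then x else y.

Lemma multitensor_slot (J : finType) k (x : 'I_k -> J -> R) (l : 'I_k) t :
  multitensor x t = x l (t l) * \prod_(l' | l' != l) x l' (t l').
Proof. by rewrite /multitensor (bigD1 l). Qed.

(** The [j]-th coordinate of the reduction map as a form on the tensor power: an average of products
    with the [j]-th coordinate form in one slot and [phi] in the others. *)
Definition reduction_form (J : finType) k (phi : J -> R) (j : J)
    (t : {ffun 'I_k -> J}) : R :=
  \sum_(l < k) k%:R^-1 * multitensor (slot_fun (fun q => (q == j)%:R) phi l) t.

Lemma reductionE (J : finType) k (phi : J -> R) z j :
  reduction k phi z j = pairing (reduction_form phi j) z.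
Proof.
rewrite pairing_suml /reduction mulr_sumr; apply: eq_bigr => l _; congr (_ * _).
rewrite /pairing big_mkcond; apply: eq_bigr => t _.
rewrite (multitensor_slot _ l) /slot_fun eqxx.
under [in RHS]eq_bigr => l' /negPf l'l do rewrite l'l.
by case: eqP => _ /=; [rewrite mul1r mulrC|rewrite !mul0r].
Qed.

Lemma reduction_multitensor (J : finType) k (phi : J -> R) (xs : 'I_k -> J -> R) j :
  pairing (reduction_form phi j) (multitensor xs) =
  k%:R^-1 * \sum_l (\prod_(l' | l' != l) pairing phi (xs l')) * xs l j.
Proof.
rewrite pairing_suml mulr_sumr; apply: eq_bigr => l _; congr (_ * _).
rewrite pairing_multitensor (bigD1 l) //= /slot_fun eqxx mulrC; congr (_ * _).
  by apply: eq_bigr => l' /negPf ->.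
by rewrite pairingC pairing_delta.
Qed.

Definition spanning (J : finType) (S : set (J -> R)) : Prop :=
  forall g : J -> R, (forall x, S x -> pairing g x = 0) -> g = (fun _ => 0).

(** The slots are freed one at a time: with the other arguments fixed, the value is a linear form in
    one slot that vanishes on [S], hence everywhere. Once all slots are free, basis tensors give the
    entries of [z]. *)
Lemma multitensor_spanning (J : finType) (S : set (J -> R)) k
    (z : {ffun 'I_k -> J} -> R) :
  spanning S ->
  (forall xs, (forall l, S (xs l)) -> pairing z (multitensor xs) = 0) ->
  z = (fun _ => 0).
Proof.
move=> spS hz.
have claim n : (n <= k)%N -> forall xs, (forall l : 'I_k, (n <= l)%N -> S (xs l)) ->
    pairing z (multitensor xs) = 0.
  elim: n => [_ xs hxs|n IH nk xs hxs]; first by apply: hz => l; exact: hxs.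
  pose o := Ordinal nk.
  pose upd x l := if l == o then x else xs l.
  have updE x : pairing (fun q => pairing z (multitensor (upd (fun p => (p == q)%:R)))) x =
      pairing z (multitensor (upd x)).
    have -> : multitensor (upd x) = (fun t => \sum_q x q *
        multitensor (upd (fun p => (p == q)%:R)) t).
      apply/funext => t.
      have rest w : \prod_(l | l != o) upd w l (t l) = \prod_(l | l != o) xs l (t l).
        by apply: eq_bigr => l /negPf lo; rewrite /upd lo.
      under eq_bigr do rewrite (multitensor_slot _ o) rest mulrA.
      rewrite -mulr_suml (multitensor_slot _ o) rest; congr (_ * _).
      by rewrite /upd eqxx -[LHS]pairing_delta; apply: eq_bigr => q _; rewrite eq_sym.
    by rewrite pairing_sumr; apply: eq_bigr => q _; rewrite mulrC.
  have g0 : (fun q => pairing z (multitensor (upd (fun p => (p == q)%:R)))) = (fun _ => 0).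
    apply: spS => x Sx; rewrite updE; apply: IH; first exact: ltnW.
    move=> l nl; rewrite /upd; have [//|lo] := eqVneq l o.
    by apply: hxs; rewrite ltn_neqAle nl andbT eq_sym -(inj_eq val_inj) in lo *.
  have -> : xs = upd (xs o) by apply/funext => l; rewrite /upd; case: eqP => [->|].
  by rewrite -updE g0 pairing0l.
apply/funext => t.
have := claim k (leqnn k) (fun l q => (q == t l)%:R).
rewrite (_ : multitensor _ = (fun s => (s == t)%:R)) ?pairing_delta.
  by apply => l; rewrite leqNgt ltn_ord.
apply/funext => s; rewrite /multitensor; have [->|st] := eqVneq s t.
  by rewrite big1 // => l _; rewrite eqxx.
have [l hl] : exists l, s l != t l.
  apply/existsP; rewrite -negb_forall; apply: contra st => /forallP h.
  by apply/eqP/ffunP => l; exact/eqP.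
by rewrite (bigD1 l) //= (negPf hl) mul0r.
Qed.

Lemma dual_cone_convex (J : finType) (C : set (J -> R)) : convex_cone (dual_cone C).
Proof.
split=> [x _|f g hf hg x Cx|a f a0 hf x Cx]; first by rewrite pairing0l.
  rewrite (_ : (fun i => _) = (fun i => 1 * f i + 1 * g i)).
    by rewrite pairing_linl !mul1r addr_ge0 ?hf ?hg.
  by apply/funext => i; rewrite !mul1r.
by rewrite pairing_scalel mulr_ge0 // hf.
Qed.

Lemma convex_cone_sum (I J : finType) (C : set (J -> R)) (c : I -> R) (u : I -> J -> R) :
  convex_cone C -> (forall i, 0 <= c i) -> (forall i, C (u i)) ->
  C (fun j => \sum_i c i * u i j).
Proof.
move=> [C0 CD CZ] c0 Cu.
elim: (index_enum I) => [|i s IH].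
  by rewrite (_ : (fun j => _) = (fun _ => 0)) //; apply/funext => j; rewrite big_nil.
rewrite (_ : (fun j => _) = (fun j => c i * u i j + \sum_(i <- s) c i * u i j)).
  by apply: CD => //; exact: CZ.
by apply/funext => j; rewrite big_cons.
Qed.

(** A form [g] vanishing on the dual cone vanishes at [phi] and at [phi + t g], hence at [g]
    itself. *)
Lemma dual_cone_spanning (J : finType) (C : set (J -> R)) phi :
  interior_vset (dual_cone C) phi -> spanning (dual_cone C).
Proof.
move=> hphi g hg; apply: pairing_self_eq0.
have [t t0 ht] := interior_line g hphi.
have := hg _ ht; rewrite (_ : (fun i => _) = (fun i => 1 * phi i + t * g i)); last first.
  by apply/funext => i; rewrite mul1r.
have phiC : dual_cone C phi := interior_subset hphi.
rewrite pairing_lin (hg _ phiC) mulr0 add0r => /eqP.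
by rewrite mulf_eq0 (gt_eqF t0) => /eqP ->.
Qed.

(** For some [t > 0] the form [phi - t x] still lies in the dual cone, so [pairing phi x] is at
    least [t * pairing x x]. *)
Lemma interior_dual_pos (J : finType) (C : set (J -> R)) phi x :
  interior_vset (dual_cone C) phi -> C x -> x != (fun _ => 0) -> 0 < pairing phi x.
Proof.
move=> hphi Cx x0; have [t t0 ht] := interior_line (fun i => - x i) hphi.
have := ht x Cx; rewrite (_ : (fun i => _) = (fun i => 1 * phi i + (- t) * x i)); last first.
  by apply/funext => i; ring.
rewrite pairing_linl mul1r mulNr subr_ge0; apply: lt_le_trans.
rewrite pmulr_rgt0 // lt_def pairing_self_ge0 andbT.
by apply: contraNneq x0 => h; apply/eqP/pairing_self_eq0; rewrite h.
Qed.

End Tensors.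

(** * From (i) to a product of simplices *)

Section Necessity.
Variable R : realType.
Variables (J : finType) (CB : set (J -> R)) (phi : J -> R) (k' : nat).
Notation k := k'.+1.
Hypothesis CBproper : proper_cone CB.
Hypothesis phi_int : interior_vset (dual_cone CB) phi.
Notation T := {ffun 'I_k -> J}.
Notation W := (max_tensor_pow CB k).

Lemma pairing_enum (I : finType) (a : 'I_#|I| -> R) (x : I -> R) :
  pairing (fun t => a (enum_rank t)) x = pairing a (fun i => x (enum_val i)).
Proof.
rewrite /pairing (reindex (@enum_val I I)) /=.
  by apply: eq_bigr => i _; rewrite enum_valK.
by apply: onW_bij; exact: enum_val_bij.
Qed.

(** A copy of the tensor power [W] indexed by an ordinal, since the test cones of (i) live in
    ['I_n -> R]. *)
Let W' : set ('I_#|T| -> R) := [set x | W (fun t => x (enum_rank t))].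

Lemma dual_pow_multitensor gs :
  (forall l, dual_cone CB (gs l)) -> dual_cone W (multitensor gs).
Proof. by move=> hg z; apply. Qed.

Lemma pow_multitensor xs : (forall l, CB (xs l)) -> W (multitensor xs).
Proof.
move=> hx fs hf; rewrite pairing_multitensor; apply: prodr_ge0 => l _.
exact: hf.
Qed.

Lemma dual_enum g : dual_cone W g -> dual_cone W' (fun i => g (enum_val i)).
Proof. by move=> hg x /hg; rewrite pairingC pairing_enum pairingC. Qed.

Lemma dual_enum_inv a : dual_cone W' a -> dual_cone W (fun t => a (enum_rank t)).
Proof.
move=> ha x Wx; rewrite pairing_enum; apply: ha.
by rewrite /W' /=; under eq_fun do rewrite enum_rankK.
Qed.

(** Products of vectors of [CB] lie in the power and span, so its dual contains no line; products of
    forms of the dual cone lie in that dual and span as well, so it lies in no hyperplane. *)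
Lemma dual_pow_proper : proper_cone (dual_cone W').
Proof.
have [_ _ _ spCB] := CBproper.
split; [exact: dual_cone_convex|exact: dual_cone_closed| |].
  move=> a ha hna.
  have h0 : (fun t => a (enum_rank t)) = (fun _ : T => 0).
    apply: (@multitensor_spanning _ _ CB) => // xs hxs.
    apply/eqP; rewrite eq_le (dual_enum_inv ha (pow_multitensor hxs)) andbT.
    have := dual_enum_inv hna (pow_multitensor hxs).
    rewrite (_ : (fun t => - _) = (fun t => -1 * a (enum_rank t))).
      by rewrite pairing_scalel mulN1r oppr_ge0.
    by apply/funext => t; rewrite mulN1r.
  apply/funext => i; have := congr1 (fun g => g (enum_val i)) h0.
  by rewrite /= enum_valK.
move=> f hf.
have h0 : (fun t => f (enum_rank t)) = (fun _ : T => 0).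
  apply: (multitensor_spanning (dual_cone_spanning phi_int)) => gs hgs.
  by rewrite pairing_enum; apply: hf; exact/dual_enum/dual_pow_multitensor.
apply/funext => i; have := congr1 (fun g => g (enum_val i)) h0.
by rewrite /= enum_valK.
Qed.

Lemma reduction_entanglement_breaking :
  (forall (n : nat) (CA : set ('I_n -> R)), proper_cone CA ->
     min_tensor CA CB =
     (id_tensor_map (reduction k phi)) @` (max_tensor CA W)) ->
  exists (N : nat) (a : 'I_N -> T -> R) (Y : 'I_N -> J -> R),
    [/\ forall q, dual_cone W (a q), forall q, CB (Y q) &
        forall t j, reduction_form phi j t = \sum_q a q t * Y q j].
Proof.
move=> /(_ _ _ dual_pow_proper) hmin.
(* The identity tensor: it pairs with [tensor f g] to the value of [f] on [g], and its image under
   the reduction map is the family [reduction_form]. *)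
pose z : 'I_#|T| * T -> R := fun p => (p.2 == enum_val p.1)%:R.
have zmax : max_tensor (dual_cone W') W z.
  move=> f g hf hg; have := hf _ (dual_enum hg); congr (_ <= _).
  rewrite /pairing -(pair_big predT predT (fun i t => tensor f g (i, t) * z (i, t))) /=.
  apply: eq_bigr => i _; rewrite /tensor /z /= -[f i * g _]/(f i * g (enum_val i)).
  rewrite -(pairing_delta g) mulr_sumr; apply: eq_bigr => t _; rewrite mulrA //.
have : min_tensor (dual_cone W') CB (id_tensor_map (reduction k phi) z).
  by rewrite hmin; exists z.
move=> [N [w [p [w0 _ hp E]]]].
have /choice [X hX] : forall i, exists x, exists y,
    [/\ dual_cone W' x, CB y & p i = tensor x y] by exact: hp.
have /choice [Y hY] := hX.
exists N, (fun q t => w q * X q (enum_rank t)), Y; split.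
- move=> q x Wx; rewrite pairing_scalel mulr_ge0 //.
  by have [hx _ _] := hY q; exact: (dual_enum_inv hx).
- by move=> q; have [] := hY q.
- move=> t j; have := congr1 (fun g => g (enum_rank t, j)) E.
  rewrite /id_tensor_map /= reductionE /z /= enum_rankK pairing_delta => ->.
  by apply: eq_bigr => q _; have [_ _ ->] := hY q; rewrite /tensor /= mulrA.
Qed.

(** The decomposition is refined to one over vertices and facets: the normalised [Y q] yield the
    vertices, minimal generators of the dual cone are the facets, and each [a q] is a nonnegative
    combination of products of facets. *)
Lemma product_of_simplices_of_breaking (N : nat) (a : 'I_N -> T -> R) (Y : 'I_N -> J -> R) :
  (0 < #|J|)%N ->
  (forall q, dual_cone W (a q)) -> (forall q, CB (Y q)) ->
  (forall t j, reduction_form phi j t = \sum_q a q t * Y q j) ->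
  exists (r : nat) (d : 'I_r -> nat),
    (r <= k)%N /\ affinely_equivalent (K_phi CB phi) (simplex_prod d).
Proof.
move=> J0 ha hY hred.
have [convCB _ _ spCB] := CBproper.
have [CB0 _ CBZ] := convCB.
have phi_pos x : CB x -> x != (fun _ => 0) -> 0 < pairing phi x.
  exact: interior_dual_pos.
have phi_ge0 x : CB x -> 0 <= pairing phi x by move=> Cx; exact: (interior_subset phi_int).
have phi_eq0 x : CB x -> pairing phi x = 0 -> x = (fun _ => 0).
  move=> Cx px; apply/eqP; apply: contraT => /(phi_pos _ Cx).
  by rewrite px ltxx.
(* As [J] is nonempty, the constant form 1 is nonzero and cannot vanish on all of [CB], which thus
   contains a nonzero vector. *)
have [x0 [Cx0 px0]] : exists x0, CB x0 /\ pairing phi x0 = 1.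
  have [x [Cx xn0]] : exists x, CB x /\ x <> (fun _ => 0).
    apply: contrapT => /forallNP hn.
    have /(congr1 (fun g => g (enum_val (Ordinal J0)))) /= /eqP :
        (fun _ : J => 1 : R) = (fun _ => 0).
      apply: spCB => x Cx; have [->|/eqP xn] := eqVneq x (fun _ => 0).
        exact: pairing0.
      by case: (hn x).
    by rewrite oner_eq0.
  have px : 0 < pairing phi x by apply: phi_pos => //; exact/eqP.
  exists (fun j => (pairing phi x)^-1 * x j); split; first by apply: CBZ => //; rewrite invr_ge0 ltW.
  by rewrite pairing_scale mulVf // gt_eqF.
(* A vanishing [Y q] cannot be normalised; [x0] replaces it and enters with coefficient
   [pairing phi (Y q) = 0]. *)
pose nY q : J -> R := if pairing phi (Y q) == 0 then x0
  else fun j => (pairing phi (Y q))^-1 * Y q j.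
have nYC q : CB (nY q).
  by rewrite /nY; case: ifP => // _; apply: CBZ => //; rewrite invr_ge0 phi_ge0.
have nYphi q : pairing phi (nY q) = 1.
  by rewrite /nY; case: eqP => [//|/eqP h]; rewrite pairing_scale mulVf.
have YE q j : Y q j = pairing phi (Y q) * nY q j.
  rewrite /nY; case: eqP => [h|/eqP h]; last by rewrite mulVKf.
  by rewrite h mul0r (phi_eq0 _ (hY q) h).
have id_nY xs j : \sum_q (pairing phi (Y q) * pairing (a q) (multitensor xs)) * nY q j =
    k%:R^-1 * \sum_l (\prod_(l' | l' != l) pairing phi (xs l')) * xs l j.
  rewrite -reduction_multitensor (_ : reduction_form phi j = fun t => \sum_q Y q j * a q t).
    rewrite pairing_suml; apply: eq_bigr => q _; rewrite YE; ring.
  by apply/funext => t; rewrite hred; apply: eq_bigr => q _; rewrite mulrC.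
have coef0 q xs : (forall l, CB (xs l)) ->
    0 <= pairing phi (Y q) * pairing (a q) (multitensor xs).
  by move=> hxs; rewrite mulr_ge0 ?phi_ge0 //; apply: ha; exact: pow_multitensor.
have CB_nY x : CB x -> fg_cone nY x.
  move=> Cx; have [->|xn0] := eqVneq x (fun _ => 0).
    by exists (fun _ => 0); split=> //; apply/funext => j; rewrite big1 // => q _; rewrite mul0r.
  have px := phi_pos _ Cx xn0.
  have pk : 0 < pairing phi x ^+ k' by rewrite exprn_gt0.
  exists (fun q => (pairing phi x ^+ k')^-1 *
      (pairing phi (Y q) * pairing (a q) (multitensor (fun _ => x)))); split.
    by move=> q; rewrite mulr_ge0 ?coef0 // invr_ge0 ltW.
  apply/funext => j; under eq_bigr do rewrite -mulrA.
  rewrite -mulr_sumr id_nY.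
  have -> : \sum_(l < k) (\prod_(l' | l' != l) pairing phi x) * x j =
      \sum_(l < k) pairing phi x ^+ k' * x j.
    apply: eq_bigr => l _; congr (_ * _).
    by rewrite prodr_const cardC1 card_ord.
  rewrite sumr_const card_ord -(mulr_natl (pairing phi x ^+ k' * x j) k) mulKf ?pnatr_eq0 //.
  by rewrite mulKf // gt_eqF.
have nY_ge0 q : 0 <= pairing phi (nY q) by rewrite nYphi ler01.
have [|p [y [yY nYy irr]]] := minimal_generators nY_ge0.
  by move=> q /eqP; rewrite nYphi oner_eq0.
have phiy e : pairing phi (y e) = 1 by have [q ->] := yY e.
have yC e : CB (y e) by have [q ->] := yY e.
have CBE : CB = fg_cone y.
  apply/seteqP; split=> [x /CB_nY[b [b0 ->]]|x [b [b0 ->]]].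
    exact: fg_cone_sum.
  exact: convex_cone_sum.
have [M [h hM]] := weyl y.
(* The sum of the vertices is positive on nonzero forms of the dual cone, as [minimal_generators]
   demands. *)
pose e0 : J -> R := fun j => \sum_e 1 * y e j.
have hge r e : 0 <= pairing (h r) (y e) by apply: (hM _).1; exact: fg_cone_gen.
have h0 r : 0 <= pairing e0 (h r).
  by rewrite pairingC pairing_sumr; apply: sumr_ge0 => e _; rewrite mul1r.
have [|pF [f [fh hf irrf]]] := minimal_generators h0.
  move=> r; rewrite pairingC pairing_sumr => /eqP.
  rewrite psumr_eq0 => [/allP hr|e _]; last by rewrite mul1r.
  apply: spCB => x; rewrite CBE => -[b [_ ->]]; rewrite pairing_sumr big1 // => e _.
  by have := hr e (mem_index_enum _); rewrite /= mul1r => /eqP ->; rewrite mulr0.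
have P0 b e : 0 <= slack y f b e by rewrite /slack; have [r ->] := fh b.
have conef x : (forall b, 0 <= pairing (f b) x) -> fg_cone y x.
  move=> hx; apply: (hM _).2 => r; have [c [c0 ->]] := hf r.
  by rewrite pairing_suml; apply: sumr_ge0 => b _; rewrite mulr_ge0.
have dualf g : (forall e, 0 <= pairing g (y e)) -> fg_cone f g.
  move=> hg; apply: farkas => x /conef [b [b0 ->]].
  by rewrite pairing_sumr; apply: sumr_ge0 => e _; rewrite mulr_ge0.
(* Were every vertex on [b] also on [b'], then [f b - e f b'] would lie in the dual cone for small
   [e], and [f b] would have a representation using [f b']. *)
have sep_facets b b' : b != b' -> exists e, slack y f b e = 0 /\ 0 < slack y f b' e.
  move=> bb'; apply: contrapT => /forallNP hn.
  have [|e [e_gt0 he]] := @small_eps _ _ _ (slack y f b') (P0 b).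
    move=> e be; rewrite leNgt; apply/negP => b'e; exact: (hn e).
  have [c [c0 hc]] : fg_cone f (fun j => 1 * f b j + (- e) * f b' j).
    apply: dualf => e1; rewrite pairing_linl mul1r mulNr subr_ge0; exact: he.
  have /(_ b') : forall i, c i + e * (i == b')%:R = (i == b)%:R.
    apply: irrf => [i|]; first by rewrite addr_ge0 // mulr_ge0 // ltW.
    apply/funext => j; have := congr1 (fun g => g j) hc; rewrite /= => hcj.
    transitivity (\sum_i c i * f i j + e * f b' j); first by rewrite -hcj; ring.
    rewrite -(sum_delta b' (fun b => f b j)) mulr_sumr -big_split.
    by apply: eq_bigr => i _ /=; ring.
  rewrite eqxx eq_sym (negPf bb') mulr1 /=; have := c0 b'; lra.
(* If [f b] vanished at all vertices, [- f b] would lie in the dual cone, and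
   [f b = 2 f b + (- f b)] would give it a coefficient at least 2. *)
have f_neq0 b : exists e, 0 < slack y f b e.
  apply: contrapT => /forallNP hn.
  have [c [c0 hc]] : fg_cone f (fun j => - 1 * f b j).
    apply: dualf => e; rewrite pairing_scalel mulN1r oppr_ge0 leNgt.
    by apply/negP; exact: hn.
  have /(_ b) : forall i, (i == b)%:R *+ 2 + c i = (i == b)%:R.
    apply: irrf => [i|]; first by rewrite addr_ge0 // mulrn_wge0.
    apply/funext => j; have := congr1 (fun g => g j) hc; rewrite /= => hcj.
    transitivity (2 * f b j + \sum_i c i * f i j); first by rewrite -hcj; ring.
    rewrite -(sum_delta b (fun b => f b j)) mulr_sumr -big_split.
    by apply: eq_bigr => i _ /=; ring.
  by rewrite eqxx mulr2n /=; have := c0 b; lra.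
(* The [f b] generate the dual cone, so the power is cut out by products of facets alone, and
   Farkas' lemma applies to [a q]. *)
have /choice [al hal] : forall q, fg_cone (fun s : {ffun 'I_k -> 'I_pF} =>
    multitensor (fun l => f (s l))) (a q).
  move=> q; apply: farkas => z hz; apply: ha => gs hgs.
  have /choice [c hc] : forall l, fg_cone f (gs l).
    by move=> l; apply: dualf => e; apply: hgs.
  have -> : gs = (fun l j => \sum_b c l b * f b j).
    by apply/funext => l; have [_ ->] := hc l.
  rewrite multitensor_sum pairing_suml; apply: sumr_ge0 => s _.
  by rewrite mulr_ge0 // prodr_ge0 // => l _; have [] := hc l.
have /choice [be hbe] := nYy.
pose c (s : {ffun 'I_k -> 'I_pF}) e :=
  \sum_q (pairing phi (Y q) * al q s) * be q e.
have c0 s e : 0 <= c s e.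
  apply: sumr_ge0 => q _; have [al0 _] := hal q; have [be0 _] := hbe q.
  by rewrite !mulr_ge0 // phi_ge0.
have decomp xs j : \sum_e weight f c e xs * y e j =
    k%:R^-1 * \sum_l (\prod_(l' | l' != l) pairing phi (xs l')) * xs l j.
  rewrite -id_nY.
  have aE q : pairing (a q) (multitensor xs) =
      \sum_s al q s * \prod_l pairing (f (s l)) (xs l).
    have [_ {1}->] := hal q; rewrite pairing_suml.
    by apply: eq_bigr => s _; rewrite pairing_multitensor.
  have nE q : nY q j = \sum_e be q e * y e j by have [_ {1}->] := hbe q.
  under [RHS]eq_bigr do rewrite aE nE mulr_sumr.
  rewrite exchange_big; apply: eq_bigr => e _.
  under [RHS]eq_bigr do rewrite mulrA.
  rewrite -mulr_suml; congr (_ * _); rewrite /weight.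
  under eq_bigr do rewrite mulr_suml.
  rewrite exchange_big; apply: eq_bigr => q _.
  rewrite mulr_sumr mulr_suml; apply: eq_bigr => s _; ring.
have [v _] : exists v : 'I_p, True.
  apply: contrapT => /forallNP hn; have : fg_cone y x0 by rewrite -CBE.
  move=> [b [_ x0E]]; move: px0; rewrite x0E pairing_sumr big1 => [/eqP|e _].
    by rewrite eq_sym oner_eq0.
  by case: (hn e).
rewrite CBE.
exact: (product_of_simplices P0 phiy conef sep_facets f_neq0 irr c0 decomp v).
Qed.

End Necessity.

(** * From a product of simplices to (i) *)

Section Sufficiency.
Variable R : realType.
Variables (J : finType) (CB : set (J -> R)) (phi : J -> R) (k' : nat).
Notation k := k'.+1.
Hypothesis CBproper : proper_cone CB.
Hypothesis phi_int : interior_vset (dual_cone CB) phi.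
Notation W := (max_tensor_pow CB k).

Lemma cone_base x : CB x -> x = (fun _ => 0) \/
  exists a x', [/\ 0 < a, K_phi CB phi x' & x = (fun j => a * x' j)].
Proof.
move=> Cx; have [->|x0] := eqVneq x (fun _ => 0); first by left.
have px := interior_dual_pos phi_int Cx x0; right.
have [[_ _ CBZ] _ _ _] := CBproper.
exists (pairing phi x), (fun j => (pairing phi x)^-1 * x j); split=> //.
  split; first by apply: CBZ => //; rewrite invr_ge0 ltW.
  by rewrite pairing_scale mulVf // gt_eqF.
by apply/funext => j; rewrite mulVKf // gt_eqF.
Qed.

Lemma dual_cone_base g :
  (forall x, K_phi CB phi x -> 0 <= pairing g x) -> dual_cone CB g.
Proof.
move=> hg x /cone_base[->|[a [x' [a0 Kx ->]]]]; first by rewrite pairing0.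
by rewrite pairing_scale mulr_ge0 ?hg // ltW.
Qed.

Lemma base_spanning : spanning (K_phi CB phi).
Proof.
move=> g hg; have [_ _ _ spCB] := CBproper; apply: spCB.
move=> x /cone_base[->|[a [x' [a0 Kx ->]]]]; first by rewrite pairing0.
by rewrite pairing_scale hg ?mulr0.
Qed.

Lemma sum_option (V : finType) (P : pred (option V)) (F : option V -> R) :
  \sum_(o | P o) F o = (if P None then F None else 0) + \sum_(p | P (Some p)) F (Some p).
Proof.
rewrite big_mkcond (bigD1 None) //=; congr (_ + _).
rewrite (reindex_omap (@Some V) id) => [|[p|]] //=.
by rewrite [RHS]big_mkcond; apply: eq_big => // p; rewrite eqxx.
Qed.

Lemma eq_on_base g h :
  (forall x, K_phi CB phi x -> pairing g x = pairing h x) -> g =1 h.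
Proof.
move=> gh q; have := @base_spanning (fun q => 1 * g q + (- 1) * h q).
move=> h0; apply/eqP; rewrite -subr_eq0; apply/eqP.
suff /h0 /(congr1 (fun f => f q)) /= : forall x, K_phi CB phi x ->
  pairing (fun q => 1 * g q + (- 1) * h q) x = 0 by lra.
by move=> x Kx; rewrite pairing_linl gh // mul1r mulN1r subrr.
Qed.

(** For a shift [s], slot [s + i] is measured by the simplex coordinates of factor [i] and the
    remaining slots by [phi]; the outcome [F] then prepares the vertex of the base with the
    coordinates found. *)
Lemma reduction_breaking_of_simplices (r : nat) (d : 'I_r -> nat) :
  (r <= k)%N -> affinely_equivalent (K_phi CB phi) (simplex_prod d) ->
  exists (I : finType) (g : I -> 'I_k -> J -> R) (Y : I -> J -> R),
    [/\ forall i l, dual_cone CB (g i l), forall i, CB (Y i) &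
        forall t j, reduction_form phi j t =
          \sum_i k%:R^-1 * multitensor (g i) t * Y i j].
Proof.
move=> rk [T [S [[[M [b TE]] [N [b' SE]] TK SP] [ST TS]]]].
have KT x : K_phi CB phi x -> simplex_prod d (T x) by move=> Kx; rewrite -TK; exists x.
have PS s : simplex_prod d s -> K_phi CB phi (S s) by move=> Ps; rewrite -SP; exists s.
pose V := {i : 'I_r & 'I_(d i).+1}.
(* Homogenised coordinates of [T]: since [phi] is 1 on the base, the constant [b p] becomes
   [b p * phi]. *)
pose lam (p : V) : J -> R := fun q => M p q + b p * phi q.
have lamE x p : K_phi CB phi x -> pairing (lam p) x = T x p.
  move=> [_ phix]; rewrite (_ : lam p = fun q => 1 * M p q + b p * phi q).
    by rewrite pairing_linl phix TE mul1r mulr1.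
  by apply/funext => q; rewrite mul1r.
have lam_dual p : dual_cone CB (lam p).
  by apply: dual_cone_base => x Kx; rewrite lamE //; case: (KT x Kx).
have lam_sum (i : 'I_r) q : \sum_(p : V | tag p == i) lam p q = phi q.
  rewrite -(@eq_on_base (fun q => \sum_(p : V) (tag p == i)%:R * lam p q)) => [|x Kx].
    by rewrite big_mkcond; apply: eq_bigr => p _; case: ifP; rewrite ?mul1r ?mul0r.
  rewrite pairing_suml; have [_ ->] := Kx; have [_ /(_ i) Ti] := KT x Kx.
  rewrite -[RHS]Ti.
  rewrite (eq_bigr (fun p => (tag p == i)%:R * T x p)) => [|p _]; last by rewrite lamE.
  transitivity (\sum_(i' < r) \sum_(j < (d i').+1)
      (i' == i)%:R * T x (@Tagged _ i' (fun i => 'I_(d i).+1) j)).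
    by rewrite sig_big_dep /=; apply: eq_bigr => -[i' j] _.
  rewrite (bigD1 i) //= eqxx [X in _ + X]big1 ?addr0 => [|i' /negPf i'i].
    by apply: eq_bigr => j _; rewrite mul1r.
  by rewrite i'i big1 // => j _; rewrite mul0r.
have SlamE q j : \sum_p N j p * lam p q + b' j * phi q = (q == j)%:R.
  rewrite -(@eq_on_base (fun q => 1 * (\sum_p N j p * lam p q) + b' j * phi q)
    (fun q => (q == j)%:R)) ?mul1r // => x Kx.
  rewrite pairing_linl pairing_suml mul1r; have [_ ->] := Kx.
  rewrite [RHS]pairingC pairing_delta mulr1.
  have /(congr1 (fun g => g j)) := ST x Kx; rewrite SE => <-; congr (_ + _).
  by apply: eq_bigr => p _; rewrite lamE.
pose L (o : option V) : J -> R := if o is Some p then lam p else phi.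
(* Admissible outcomes before the shift: a coordinate of factor [l] if [l < r], and otherwise
   [None], which stands for [phi]. *)
pose Q (l : 'I_k) (o : option V) : bool :=
  if o is Some p then tag p == l :> nat else (r <= l)%N.
have QL l q : \sum_(o | Q l o) L o q = phi q.
  rewrite sum_option /= /Q; case: leqP => lr.
    rewrite big1 ?addr0 // => p /eqP e.
    by move: lr; rewrite -e leqNgt ltn_ord.
  rewrite add0r -(lam_sum (Ordinal lr)).
  by apply: eq_bigl => p; rewrite -val_eqE.
pose wid (i : 'I_r) : 'I_k := widen_ord rk i.
pose pt (F : {ffun 'I_k -> option V}) : V -> R := fun p => (F (wid (tag p)) == Some p)%:R.
have ptP F : F \in family Q -> simplex_prod d (pt F).
  move=> /familyP hF; split=> [p|i]; first by rewrite ler0n.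
  have := hF (wid i); rewrite /pt /=; case: (F (wid i)) => [[i0 j0]|].
    rewrite unfold_in /= => /eqP /val_inj e; move: j0; rewrite e => j0.
    rewrite (bigD1 j0) //= eqxx big1 ?addr0 // => j /negPf jj0.
    rewrite (_ : (_ == _) = false) //; apply/negbTE; apply: contraFN jj0.
    by move=> /eqP[] /eqP; rewrite eq_Tagged /= eq_sym.
  by rewrite unfold_in /= leqNgt ltn_ord.
pose g (sF : 'I_k * {ffun 'I_k -> option V}) (l : 'I_k) := L (sF.2 (l - sF.1)).
(* The default 0 lets the sum run over all [F], admissible or not. *)
pose Y (sF : 'I_k * {ffun 'I_k -> option V}) : J -> R :=
  if sF.2 \in family Q then S (pt sF.2) else (fun _ => 0).
exists ('I_k * {ffun 'I_k -> option V})%type, g, Y; split.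
- move=> [s F] l; rewrite /g /L; case: (F _) => [p|]; first exact: lam_dual.
  exact: (interior_subset phi_int).
- move=> [s F]; rewrite /Y; case: ifP => [/ptP/PS[]//|_].
  by have [[]] := CBproper.
move=> t j.
rewrite -(pair_big predT predT (fun s F => k%:R^-1 * multitensor (g (s, F)) t * Y (s, F) j)) /=.
have shift s F : multitensor (g (s, F)) t = \prod_m L (F m) (t (m + s)).
  rewrite /multitensor (reindex_inj (addIr s)) /=.
  by apply: eq_bigr => m _; rewrite /g /= addrK.
have total u : \sum_(F in family Q) \prod_m L (F m) (u m) = \prod_m phi (u m).
  by rewrite -(bigA_distr_big_dep Q (fun m o => L o (u m))); apply: eq_bigr => m _; rewrite QL.
have point u p : \sum_(F in family Q) (\prod_m L (F m) (u m)) * pt F p =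
    lam p (u (wid (tag p))) * \prod_(m | m != wid (tag p)) phi (u m).
  pose G m o := L o (u m) * (if m == wid (tag p) then (o == Some p)%:R else 1).
  rewrite (eq_bigr (fun F : {ffun _} => \prod_m G m (F m))) => [|F _].
    rewrite -(bigA_distr_big_dep Q G) (bigD1 (wid (tag p))) //=; congr (_ * _).
      rewrite (bigD1 (Some p)) /= ?eqxx // big1 ?addr0 => [|o /andP[_ /negPf op]].
        by rewrite /G !eqxx mulr1.
      by rewrite /G eqxx op mulr0.
    by apply: eq_bigr => m /negPf mp; rewrite -(QL m); apply: eq_bigr => o _; rewrite /G mp mulr1.
  rewrite /G big_split /=; congr (_ * _).
  by rewrite -big_mkcond big_pred1_eq.
have sumF s : \sum_F k%:R^-1 * multitensor (g (s, F)) t * Y (s, F) j =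
   k%:R^-1 * \sum_p (N j p * (lam p (t (wid (tag p) + s)) *
      \prod_(l | l != wid (tag p) + s) phi (t l)))
   + k%:R^-1 * (b' j * \prod_l phi (t l)).
  transitivity (\sum_(F in family Q) k%:R^-1 * (\sum_p N j p *
      ((\prod_m L (F m) (t (m + s))) * pt F p) + b' j * \prod_m L (F m) (t (m + s)))).
    rewrite [RHS]big_mkcond; apply: eq_bigr => F _; rewrite shift /Y /=.
    case: ifP => _; last by rewrite mulr0.
    rewrite SE -mulrA mulrDr mulr_sumr; congr (_ * (_ + _)); last exact: mulrC.
    by apply: eq_bigr => p _; rewrite mulrCA.
  rewrite -mulr_sumr big_split mulrDr -mulr_sumr (total (fun m => t (m + s))).
  congr (_ + _); last first.
    by congr (_ * (_ * _)); rewrite [RHS](reindex_inj (addIr s)).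
  congr (_ * _); rewrite exchange_big; apply: eq_bigr => p _.
  rewrite -mulr_sumr (point (fun m => t (m + s))); congr (_ * (_ * _)).
  rewrite [RHS](reindex_inj (addIr s)); apply: eq_bigl => m.
  by rewrite (inj_eq (addIr s)).
(* As [s] varies, [wid (tag p) + s] runs once through all slots, so the average no longer depends on
   the factor of [p]; [SlamE] then reassembles the [j]-th coordinate form. *)
rewrite (eq_bigr _ (fun s _ => sumF s)) big_split /= -mulr_sumr exchange_big /=.
rewrite (eq_bigr (fun p => \sum_l N j p * (lam p (t l) * \prod_(l' | l' != l) phi (t l')))).
  rewrite exchange_big /= mulr_sumr -big_split; apply: eq_bigr => l _ /=.
  rewrite (multitensor_slot _ l) /slot_fun eqxx -SlamE -mulrDr; congr (_ * _).
  rewrite (eq_bigr (fun l' => phi (t l'))) => [|l' /negPf -> //].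
  have -> : \prod_l' phi (t l') = phi (t l) * \prod_(l' | l' != l) phi (t l').
    by rewrite (bigD1 l).
  rewrite mulrDl mulr_suml mulrA; congr (_ + _).
  by apply: eq_bigr => p _; rewrite mulrA.
by move=> p _; rewrite [RHS](reindex_inj (addrI (wid (tag p)))).
Qed.

Lemma pairing_tensor (I I' : finType) (f x : I -> R) (g y : I' -> R) :
  pairing (tensor f g) (tensor x y) = pairing f x * pairing g y.
Proof.
rewrite /pairing -(pair_big predT predT
  (fun i j => tensor f g (i, j) * tensor x y (i, j))) /= mulr_suml.
apply: eq_bigr => i _; rewrite mulr_sumr; apply: eq_bigr => j _.
by rewrite /tensor /=; ring.
Qed.

(** The convex weights [1 / (n + 1)] are compensated by scaling the first factors; the additional
    zero term lets the weights sum to 1 even if [I] is empty. *)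
Lemma min_tensor_sum (I I' A : finType) (CA : set (A -> R)) (x : I -> A -> R)
    (C : set (I' -> R)) (y : I -> I' -> R) :
  convex_cone CA -> C (fun _ => 0) -> (forall i, CA (x i)) -> (forall i, C (y i)) ->
  min_tensor CA C (fun p => \sum_i tensor (x i) (y i) p).
Proof.
move=> [CA0 _ CAZ] C0 hx hy; pose n := #|I|.
have n0 : n.+1%:R != 0 :> R by rewrite pnatr_eq0.
exists n.+1, (fun _ => n.+1%:R^-1), (fun i : 'I_n.+1 =>
  if unlift ord0 i is Some i' then
    tensor (fun a => n.+1%:R * x (enum_val i') a) (y (enum_val i')) else (fun _ => 0)).
split.
- by move=> i; rewrite invr_ge0 ler0n.
- by rewrite sumr_const card_ord -(mulr_natl (_^-1) n.+1) mulfV.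
- move=> i; case: unliftP => [i' _|_].
    exists (fun a => n.+1%:R * x (enum_val i') a), (y (enum_val i')); split=> //.
    by apply: CAZ => //; rewrite ler0n.
  exists (fun _ => 0), (fun _ => 0); split=> //.
  by apply/funext => p; rewrite /tensor mul0r.
- apply/funext => p; rewrite big_ord_recl unlift_none mulr0 add0r.
  rewrite (reindex (@enum_val I I)) /=; last by apply: onW_bij; exact: enum_val_bij.
  by apply: eq_bigr => i _; rewrite liftK /tensor mulrA mulKf.
Qed.

(** A product of [x] and [y] is the image of [x] times the [k]-th power of [y], divided by
    [pairing phi y ^+ k']. Conversely, contracting [z] with the product form of [g i] gives a vector
    of [CA] by the bipolar theorem, so the image of [z] is a sum of products. *)
Lemma min_tensor_eq_of_breaking (I : finType) (g : I -> 'I_k -> J -> R) (Y : I -> J -> R)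
    (A : finType) (CA : set (A -> R)) :
  (forall i l, dual_cone CB (g i l)) -> (forall i, CB (Y i)) ->
  (forall t j, reduction_form phi j t = \sum_i k%:R^-1 * multitensor (g i) t * Y i j) ->
  proper_cone CA ->
  min_tensor CA CB = (id_tensor_map (reduction k phi)) @` (max_tensor CA W).
Proof.
move=> hg hY hred [convA clA _ _]; have [convB _ _ _] := CBproper.
apply/seteqP; split=> [z [N [w [p [w0 _ hp ->]]]]|_ [z hz <-]].
  have /choice [X hX] : forall i, exists x, exists y,
      [/\ CA x, CB y & p i = tensor x y] by exact: hp.
  have /choice [y hy] := hX.
  have phiy i : 0 <= pairing phi (y i).
    by have [_ Cy _] := hy i; exact: (interior_subset phi_int).
  pose c i := w i * (pairing phi (y i) ^+ k')^-1.
  exists (fun q => \sum_i c i * tensor (X i) (multitensor (fun _ : 'I_k => y i)) q).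
    move=> f h hf hh; rewrite pairing_sumr; apply: sumr_ge0 => i _.
    have [Xi Cy _] := hy i.
    rewrite !mulr_ge0 ?invr_ge0 ?exprn_ge0 // pairing_tensor mulr_ge0 ?hf ?hh //.
    move=> fs hfs; rewrite pairing_multitensor prodr_ge0 // => l _; exact: hfs.
  apply/funext => -[a j]; rewrite /id_tensor_map /= reductionE.
  transitivity (\sum_i (c i * X i a) *
      pairing (reduction_form phi j) (multitensor (fun _ : 'I_k => y i))).
    rewrite -pairing_sumr; congr (pairing _ _); apply/funext => t.
    by apply: eq_bigr => i _; rewrite /tensor /= mulrA.
  apply: eq_bigr => i _; have [_ Cy ->] := hy i.
  rewrite reduction_multitensor /tensor /=.
  have -> : \sum_(l < k) (\prod_(l' | l' != l) pairing phi (y i)) * y i j =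
      \sum_(l < k) pairing phi (y i) ^+ k' * y i j.
    by apply: eq_bigr => l _; rewrite prodr_const cardC1 card_ord.
  rewrite sumr_const card_ord -(mulr_natl (pairing phi (y i) ^+ k' * y i j) k).
  rewrite mulKf ?pnatr_eq0 // /c.
  have [yi0|yi0] := eqVneq (y i) (fun _ => 0); first by rewrite yi0 !mulr0.
  have py := interior_dual_pos phi_int Cy yi0.
  by field; rewrite expf_neq0 // gt_eqF.
pose x i a := k%:R^-1 * pairing (multitensor (g i)) (fun t => z (a, t)).
rewrite (_ : id_tensor_map _ z = fun q => \sum_i tensor (x i) (Y i) q).
  apply: min_tensor_sum => //; first by have [] := convB.
  move=> i; apply: bipolar => // f hf.
  rewrite pairing_scale mulr_ge0 ?invr_ge0 ?ler0n //.
  have := hz f (multitensor (g i)) hf _; rewrite (_ : pairing (tensor _ _) z =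
      pairing f (fun a => pairing (multitensor (g i)) (fun t => z (a, t)))).
    by apply=> z' hz'; exact: hz'.
  transitivity (\sum_p tensor f (multitensor (g i)) (p.1, p.2) * z (p.1, p.2)).
    by apply: eq_bigr => -[a t].
  rewrite -(pair_big predT predT
    (fun a t => tensor f (multitensor (g i)) (a, t) * z (a, t))) /=.
  apply: eq_bigr => a _; rewrite mulr_sumr; apply: eq_bigr => t _.
  by rewrite /tensor /= mulrA.
apply/funext => -[a j]; rewrite /id_tensor_map /= reductionE.
rewrite (_ : reduction_form phi j = fun t => \sum_i (k%:R^-1 * Y i j) * multitensor (g i) t).
  by rewrite pairing_suml; apply: eq_bigr => i _; rewrite /tensor /x /=; ring.
by apply/funext => t; rewrite hred; apply: eq_bigr => i _; ring.
Qed.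

End Sufficiency.

Theorem theorem2 (R : realType) (m : nat) (CB : set ('I_m -> R))
  (phi : 'I_m -> R) (k : nat) :
  (0 < m)%N ->
  proper_cone CB ->
  interior_vset (dual_cone CB) phi ->
  (1 <= k)%N ->
  ((forall (n : nat) (CA : set ('I_n -> R)), proper_cone CA ->
       min_tensor CA CB =
       (id_tensor_map (reduction k phi)) @` (max_tensor CA (max_tensor_pow CB k)))
   <->
   (exists (r : nat) (d : 'I_r -> nat),
       (r <= k)%N /\ affinely_equivalent (K_phi CB phi) (simplex_prod d))).
Proof.
move=> m0 CBproper phi_int; case: k => // k' _; split.
  move=> /(reduction_entanglement_breaking CBproper phi_int)[N [a [Y [ha hY hred]]]].
  apply: (product_of_simplices_of_breaking CBproper phi_int _ ha hY hred).
  by rewrite card_ord.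
move=> [r [d [rk KP]]] n CA CAproper.
have [I [g [Y [hg hY hred]]]] :=
  reduction_breaking_of_simplices CBproper phi_int rk KP.
exact: (min_tensor_eq_of_breaking CBproper phi_int hg hY hred CAproper).
Qed.
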